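(* Let $E \subset \mathbb{F}_q^d$, and suppose $t_i \neq 0$ for $1 \le i \le k$. For $\vec t = (t_1,\dots,t_k)$, define $$\nu_k(\vec t) = \left|\left\{(x,x^1,\dots,x^k) \in E^{k+1} : \|x - x^i\| = t_i,\ x^i = x^j \iff i = j,\ 1 \le i \le k\right\}\right|.$$ (i) If $|E| > 12 q^{\frac{d+1}{2}}$, then $\nu_k(\vec t) > 0$ for any $k < \dfrac{|E|}{12 q^{\frac{d+1}{2}}}$. (ii) If $|E| > 12 q^{\frac{d+3}{2}}$, then $\nu_k(\vec t) > 0$ for any $k < \dfrac{|E|}{12 q}$.
   Context: $\mathbb{F}_q$ is a finite field with $q$ elements and $\mathbb{F}_q^d$ is the $d$-dimensional vector space over it. $k \ge 1$ is an integer and the $t_i$ are elements of $\mathbb{F}_q$. For $x=(x_1,\dots,x_d) \in \mathbb{F}_q^d$, $\|x\| = x_1^2 + \dots + x_d^2 \in \mathbb{F}_q$. $|S|$ denotes the number of elements of a finite set $S$. The condition ''$x^i = x^j \iff i = j$'' means that $x^1,\dots,x^k$ are pairwise distinct; $\nu_k(\vec t)$ counts the $k$-stars in $E$ with center $x$ and edge lengths $t_1,\dots,t_k$.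
   Formalization: The formal theorem assumes q is odd; for even q the claim fails, since ‖x‖ = (x_1+…+x_d)^2 and E = {x_1+…+x_d = 0} (e.g. d = 4, q = 256 for (i); d = 6, q = 256 for (ii)) has no nonzero distances. *)

(* Defs.v *)
From mathcomp Require Import all_boot all_order all_algebra.

Set Implicit Arguments.
Unset Strict Implicit.
Unset Printing Implicit Defensive.

Import GRing.Theory.
Local Open Scope ring_scope.

(* Despite the usual notation ||x||, this is an element of F, with no square
   root taken. *)
Definition sqnorm (F : finFieldType) (d : nat) (x : 'rV[F]_d) : F :=
  \sum_(i < d) x 0 i ^+ 2.

(* The tuple (x, x^1, ..., x^k) is the pair of the center x = p.1 and the
   family p.2 of the leaves. *)
Definition stars (F : finFieldType) (d : nat) (E : {set 'rV[F]_d})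
    (k : nat) (t : 'I_k -> F) : {set 'rV[F]_d * {ffun 'I_k -> 'rV[F]_d}} :=
  [set p : 'rV[F]_d * {ffun 'I_k -> 'rV[F]_d} |
    [&& p.1 \in E,
        [forall i, p.2 i \in E],
        [forall i, sqnorm (p.1 - p.2 i) == t i] &
        [forall i, forall j, (p.2 i == p.2 j) == (i == j)]]].

Definition nu (F : finFieldType) (d : nat) (E : {set 'rV[F]_d})
    (k : nat) (t : 'I_k -> F) : nat :=
  #|stars E t|.

(* Main.v *)
Require Import Defs.
From mathcomp Require Import all_boot all_order all_fingroup all_algebra.
From mathcomp Require Import all_solvable all_field all_character qfpoly.
From mathcomp Require Import zify ring lra.
From mathcomp Require Import reals exp.

Set Implicit Arguments.
Unset Strict Implicit.
Unset Printing Implicit Defensive.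

Import Order.TTheory GRing.Theory Num.Theory.
Local Open Scope ring_scope.

(** For t <> 0 let deg_t(x) be the number of y in E with ||x - y|| = t. A star
    with center x exists as soon as deg_t(x) >= k for each t among the t_i: its
    leaves can then be chosen one after the other ([greedy_injection]). Such a
    center exists because distance graphs are pseudo-random. The function
    q deg_t - |E| is the convolution of the indicator function of E with an
    explicit kernel, whose Fourier transform is at most 2 q^((d+1)/2) in
    absolute value ([FT_sphere_kernel_bound]); Plancherel's identity then bounds
    the variance of deg_t ([degree_variance]), Chebyshev's inequality bounds the
    number of centers that are bad for t ([few_bad_centers]), and a union bound
    over the values t_i leaves a good center ([exists_rich_center]). There are
    at most k values t_i, which is what hypothesis (i) pays for, and at most q,
    which is what hypothesis (ii) pays for.

    The Fourier transform of the kernel is computed by completing squares: up to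
    a factor of absolute value q^(d/2), it is a Kloosterman sum when d is even
    and a Salie sum when d is odd. Salie sums are evaluated by
    undoing the completion of squares ([salie_bound]). Kloosterman sums
    K = sum of psi(x + a/x) need Weil's bound |K| <= 2 sqrt q
    ([kloosterman_bound]), which rests on two facts.

    - Amplification ([hasse_davenport]): if L is the quadratic extension of k and
      K_L, K_k are the sums over L and k, then K_L = 2 |k| - K_k^2. So if
      |K_k|^2 / |k| exceeds 4 for one field, then this ratio tends to infinity
      along the tower of iterated quadratic extensions of that field.
    - A weak bound with a constant that is uniform in the tower
      ([kloosterman_stepanov]): over an extension of F_q with s^2 elements, s a
      large power of q, one has |K| <= 2 q s + 1. It comes from an upper bound
      for the number of points of the curves y^q - y = x + a/x - e
      ([stepanov_bound]), proved by Bombieri's version of Stepanov's method: a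
      polynomial of small degree that vanishes at all rational points is found
      by linear algebra. *)

(** * Points on the curves y^q - y = x + a/x - e *)

Section Bivariate.
Variable k : finFieldType.
Implicit Types P Q : {poly {poly k}}.

(** Polynomials in two variables are elements of {poly {poly k}}: the
    coefficients are polynomials in X and the outer variable is Y. This bounds
    the degree in X alone. *)
Definition xdeg_le (n : nat) P := forall j, (size (P`_j)%R <= n.+1)%N.

Lemma xdeg_leW m n P : (m <= n)%N -> xdeg_le m P -> xdeg_le n P.
Proof. by move=> mn hP j; apply: leq_trans (hP j) _. Qed.

Lemma xdeg_le0 n : xdeg_le n 0.
Proof. by move=> j; rewrite coef0 size_poly0. Qed.

Lemma xdeg_leD n P Q : xdeg_le n P -> xdeg_le n Q -> xdeg_le n (P + Q).
Proof.
move=> hP hQ j; rewrite coefD (leq_trans (size_polyD _ _)) // geq_max.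
by rewrite hP hQ.
Qed.

Lemma xdeg_leN n P : xdeg_le n P -> xdeg_le n (- P).
Proof. by move=> hP j; rewrite coefN size_polyN. Qed.

Lemma xdeg_le_sum n (I : Type) (r : seq I) (C : pred I) (F : I -> {poly {poly k}}) :
  (forall i, C i -> xdeg_le n (F i)) -> xdeg_le n (\sum_(i <- r | C i) F i).
Proof.
move=> hF; elim/big_rec: _ => [|i P Ci]; first exact: xdeg_le0.
by apply: xdeg_leD; apply: hF.
Qed.

Lemma xdeg_leM m n P Q : xdeg_le m P -> xdeg_le n Q -> xdeg_le (m + n) (P * Q).
Proof.
move=> hP hQ j; rewrite coefM (leq_trans (size_sum _ _ _)) //.
apply/bigmax_leqP => i _; apply: leq_trans (size_polyMleq _ _) _.
by have := hP i; have := hQ (j - i)%N; lia.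
Qed.

Lemma xdeg_leC n (c : {poly k}) : (size c <= n.+1)%N -> xdeg_le n c%:P.
Proof. by move=> hc j; rewrite coefC; case: ifP => // _; rewrite size_poly0. Qed.

Lemma xdeg_leX n : xdeg_le 0 'X^n.
Proof. by move=> j; rewrite coefXn; case: eqP => _; rewrite ?size_poly1 ?size_poly0.
  Qed.

Lemma xdeg_le_varY : xdeg_le 0 'X.
Proof. by rewrite -['X]expr1; apply: xdeg_leX. Qed.

Lemma xdeg_leXn m n P : xdeg_le m P -> xdeg_le (m * n) (P ^+ n).
Proof.
move=> hP; elim: n => [|n IH]; first by rewrite muln0 expr0; apply: (xdeg_leX 0).
by rewrite mulnS exprS; apply: xdeg_leM.
Qed.

Lemma xdeg_leZ n (c : k) P : xdeg_le n P -> xdeg_le n (c%:P *: P).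
Proof.
move=> hP; rewrite -mul_polyC; apply: (@xdeg_leM 0 n) => //.
by apply: xdeg_leC; rewrite size_polyC; case: eqP.
Qed.

Definition eval2 (x y : k) P : k := P.[y%:P].[x].

Lemma eval2D x y P Q : eval2 x y (P + Q) = eval2 x y P + eval2 x y Q.
Proof. by rewrite /eval2 !hornerD. Qed.
Lemma eval2M x y P Q : eval2 x y (P * Q) = eval2 x y P * eval2 x y Q.
Proof. by rewrite /eval2 !hornerM. Qed.
Lemma eval2C x y c : eval2 x y c%:P = c.[x].
Proof. by rewrite /eval2 hornerC. Qed.
Lemma eval2Y x y : eval2 x y 'X = y.
Proof. by rewrite /eval2 hornerX hornerC. Qed.
Lemma eval2Xn x y P n : eval2 x y (P ^+ n) = eval2 x y P ^+ n.
Proof. by rewrite /eval2 !horner_exp. Qed.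
Lemma eval2Z x y c P : eval2 x y (c *: P) = c.[x] * eval2 x y P.
Proof. by rewrite -mul_polyC eval2M eval2C. Qed.
Lemma eval2_sum x y (I : Type) (r : seq I) (C : pred I) (F : I -> {poly {poly k}}) :
  eval2 x y (\sum_(i <- r | C i) F i) = \sum_(i <- r | C i) eval2 x y (F i).
Proof. by rewrite /eval2 !horner_sum. Qed.
End Bivariate.

Section LinSolve.
Variable k : fieldType.
Lemma exists_nonzero_solution (I J : finType) (f : I -> J -> k) :
  (#|J| < #|I|)%N ->
  exists2 c : I -> k, (exists i, c i != 0) & forall j, \sum_i c i * f i j = 0.
Proof.
move=> hJI; pose A : 'M[k]_(#|I|, #|J|) := \matrix_(i, j) f (enum_val i) (enum_val j).
have : kermx A != 0.
  rewrite kermx_eq0 /row_free; apply/negP => /eqP rA.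
  by have := rank_leq_col A; rewrite rA leqNgt hJI.
case/rowV0Pn => v /sub_kermxP vA /rV0Pn [i vi].
exists (fun i => v 0 (enum_rank i)); first by exists (enum_val i); rewrite enum_valK.
move=> j; have /matrixP/(_ 0 (enum_rank j)) := vA; rewrite !mxE => vA0; rewrite
  -[RHS]vA0.
rewrite [RHS](reindex_onto enum_rank enum_val) /= => [|i' _]; last exact: enum_valK.
under [RHS]eq_bigl => i' do rewrite enum_rankK eqxx.
by apply: eq_bigr => i' _; rewrite mxE !enum_rankK.
Qed.
End LinSolve.

Section Stepanov.
Variables (k : finFieldType) (q r : nat) (a e : k).
Hypothesis q_gt1 : (1 < q)%N.
Hypothesis q_pchar : [pchar k].-nat q.
Let w := (q ^ r)%N.
Let s := (q * w)%N.
Hypothesis w_big : (q + 3 < w)%N.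
Hypothesis card_k : #|k| = (s ^ 2)%N.
Hypothesis fix_q : (q <= #|[set c : k | c ^+ q == c]|)%N.

(** Above a given x, the solutions y are the translates of any one of them by
    the q elements c with c^q = c. If there are any, all the coefficients of a
    polynomial of Y-degree less than q that vanishes at these points (x, y)
    vanish at x. *)
Definition on_curve (x y : k) := (x != 0) && (y ^+ q - y == x + a / x - e).

Lemma pchar_pow n : [pchar k].-nat (q ^ n)%N.
Proof. by rewrite pnatX q_pchar. Qed.

Lemma s_pow : s = (q ^ r.+1)%N. Proof. by rewrite expnS. Qed.

(** X times the right-hand side of the equation, to clear the denominator. *)
Definition curve_rhs : {poly k} := 'X^2 - e *: 'X + a%:P.

(** X^w times the sum of the (x + a/x - e)^(q^i) for i <= r. Iterating
    y^q = y + (x + a/x - e) shows that y^s - y is this sum on the curve: the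
    s-th power of y is again a polynomial of degree 1 in y. *)
Definition frob_shift : {poly k} :=
  \sum_(i < r.+1) ('X^(w + q ^ i) + a ^+ (q ^ i) *: 'X^(w - q ^ i)
                   - e ^+ (q ^ i) *: 'X^w).

(** Represents y^(s v) times x^(w (q-1)) with Y-degree v only. The exponent of
    X that completes each product to the common factor x^(w (q-1)) requires
    v < q. *)
Definition frob_ypow (v : nat) : {poly {poly k}} :=
  ('X^w *: 'X + frob_shift%:P) ^+ v * ('X^(w * (q.-1 - v)))%:P.

(** Eliminates Y^q by means of the equation of the curve, at the cost of a
    factor X. One pass brings the Y-degree below q for the products considered
    here, whose factors have Y-degree below q. *)
Definition reduce (P : {poly {poly k}}) : {poly {poly k}} :=
  'X *: take_poly q P + ('X *: 'X + curve_rhs%:P) * drop_poly q P.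

(** Represents the s-th power of [mon l], times x^(w (q-1)). *)
Definition frob_mon (l : nat) : {poly {poly k}} :=
  'X^(s * (l %/ q)) *: frob_ypow (l %% q).

(** The index l = q u + v of the monomial X^u Y^v, v < q, is its pole order at
    infinity, where x has a pole of order q and y has a simple pole. *)
Definition mon (l : nat) : {poly {poly k}} := 'X^(l %/ q) *: 'X^(l %% q).

Lemma reduceD P Q : reduce (P + Q) = reduce P + reduce Q.
Proof. by rewrite /reduce take_polyD drop_polyD scalerDr mulrDr addrACA. Qed.

Lemma reduceZ c P : reduce (c *: P) = c *: reduce P.
Proof.
rewrite /reduce take_polyZ drop_polyZ scalerDr scalerAr; congr (_ + _).
by rewrite !scalerA mulrC.
Qed.

Lemma reduce_sum (I : Type) (t : seq I) (C : pred I) (F : I -> {poly {poly k}}) :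
  reduce (\sum_(i <- t | C i) F i) = \sum_(i <- t | C i) reduce (F i).
Proof.
by apply: (big_morph reduce reduceD); have := reduceZ 0 0; rewrite !scale0r.
Qed.

Lemma on_curveE x y : on_curve x y -> x * y ^+ q = x * y + curve_rhs.[x].
Proof.
case/andP=> x0 /eqP h; have -> : y ^+ q = y + (x + a / x - e) by rewrite -h; ring.
by rewrite /curve_rhs !(hornerD, hornerN, hornerZ, hornerC, hornerXn, hornerX); field.
Qed.

Lemma eval2_reduce x y P : on_curve x y -> eval2 x y (reduce P) = x * eval2 x y P.
Proof.
move=> hxy; rewrite -[in RHS](poly_take_drop q P) /reduce !(eval2D, eval2M, eval2Z,
  eval2Y, eval2C, eval2Xn).
by rewrite hornerX mulrDr (mulrCA x _ (y ^+ q)) on_curveE // (mulrC (_ + _)).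
Qed.

Lemma curve_frob x y n : on_curve x y ->
  y ^+ (q ^ n) = y + \sum_(i < n) (x + a / x - e) ^+ (q ^ i).
Proof.
case/andP=> x0 /eqP h; have hy : y ^+ q = y + (x + a / x - e) by rewrite -h; ring.
elim: n => [|n IH]; first by rewrite expn0 expr1 big_ord0 addr0.
by rewrite expnS exprM hy exprDn_pchar ?pchar_pow // IH big_ord_recr addrA.
Qed.

Lemma curve_frob_shift x y : on_curve x y -> x ^+ w * y ^+ s = x ^+ w * y +
  frob_shift.[x].
Proof.
move=> hxy; have x0 : x != 0 by case/andP: hxy.
rewrite s_pow (curve_frob _ hxy) mulrDr mulr_sumr /frob_shift horner_sum.
congr (_ + _); apply: eq_bigr => i _; rewrite !(hornerD, hornerN, hornerZ, hornerXn).
have qiw : (q ^ i <= w)%N by rewrite leq_exp2l // -ltnS.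
rewrite !exprDn_pchar ?pchar_pow // exprNn_pchar ?pchar_pow // exprMn exprVn exprD.
rewrite -[in x ^+ w](subnK qiw) exprD.
have : x ^+ (q ^ i) != 0 by rewrite expf_neq0.
set X := x ^+ (q ^ i); move=> X0.
by field.
Qed.

Lemma eval2_mon x y l : eval2 x y (mon l) = x ^+ (l %/ q) * y ^+ (l %% q).
Proof. by rewrite /mon eval2Z eval2Xn eval2Y hornerXn. Qed.

Lemma eval2_frob_mon x y l : on_curve x y ->
  eval2 x y (frob_mon l) = x ^+ (w * q.-1) * eval2 x y (mon l) ^+ s.
Proof.
move=> hxy; rewrite eval2_mon /frob_mon /frob_ypow !(eval2D, eval2M, eval2Z, eval2Y,
  eval2C, eval2Xn) !hornerXn.
have hv : (l %% q <= q.-1)%N by rewrite -ltnS prednK ?ltn_mod //; lia.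
rewrite -[in RHS](subnKC hv) mulnDr exprD -curve_frob_shift // !exprMn -!exprM.
by rewrite [(s * _)%N]mulnC [(_ %% q * _)%N]mulnC; ring.
Qed.

Lemma w_gt0 : (0 < w)%N. Proof. lia. Qed.

Lemma size_frob_shift : size frob_shift = (2 * w).+1.
Proof.
have aux n (c : k) : (size (c *: 'X^n : {poly k}) <= n.+1)%N.
  by rewrite (leq_trans (size_scale_leq _ _)) // size_polyXn.
have lt_size n m (c : k) : (n < m)%N -> (size (c *: 'X^n : {poly k}) <= m)%N.
  by move=> nm; apply: leq_trans (aux _ _) _.
have eqw : (w + q ^ r = 2 * w)%N by rewrite mul2n -addnn.
rewrite /frob_shift big_ord_recr /= -/w eqw addrCA -!addrA size_polyDl ?size_polyXn //.
rewrite ltnS.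
have B (p1 p2 : {poly k}) m : (size p1 <= m -> size p2 <= m -> size (p1 + p2)%R <= m)%N.
  by move=> h1 h2; rewrite (leq_trans (size_polyD _ _)) // geq_max h1.
have wpos := w_gt0.
apply: (B); last apply: (B); rewrite ?size_polyN; try by apply: lt_size; lia.
apply: leq_trans (size_sum _ _ _) _; apply/bigmax_leqP => i _.
have qi : (q ^ i < w)%N by rewrite ltn_exp2l.
apply: (B); last by rewrite size_polyN; apply: lt_size; lia.
apply: (B); last by apply: lt_size; lia.
by rewrite size_polyXn; lia.
Qed.

Definition frob_ypow_lead (v : nat) : {poly k} := frob_shift ^+ v * 'X^(w * (q.-1 - v)).

Lemma size_frob_ypow_lead v : (v < q)%N -> size (frob_ypow_lead v) = (w * (q.-1 +
  v)).+1.
Proof.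
move=> vq; have tau0 : frob_shift != 0 by rewrite -size_poly_gt0 size_frob_shift.
rewrite /frob_ypow_lead size_mulXn ?expf_neq0 //.
have -> : size (frob_shift ^+ v) = (2 * w * v).+1.
  by have := size_exp frob_shift v; rewrite size_frob_shift /= => <-; rewrite prednK
    // size_poly_gt0 expf_neq0.
by rewrite addnS; congr _.+1; nia.
Qed.

Lemma xdeg_le_base : xdeg_le (2 * w) ('X^w *: 'X + frob_shift%:P).
Proof.
apply: xdeg_leD; last by apply: xdeg_leC; rewrite size_frob_shift.
rewrite -mul_polyC -[(2 * w)%N]addn0; apply: xdeg_leM; last by apply: xdeg_le_varY.
by apply: xdeg_leC; rewrite size_polyXn; lia.
Qed.

Lemma frob_ypow_leadP v : (v < q)%N -> xdeg_le (w * (q.-2 + v)) (frob_ypow v -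
  (frob_ypow_lead v)%:P).
Proof.
move=> vq; rewrite /frob_ypow /frob_ypow_lead polyCM -mulrBl [(frob_shift ^+
  v)%:P]polyC_exp subrXX.
case: v vq => [|v] vq; first by rewrite big_ord0 mulr0 mul0r; apply: xdeg_le0.
have -> : (w * (q.-2 + v.+1) = w + 2 * w * v + w * (q.-1 - v.+1))%N by nia.
apply: xdeg_leM; last by apply: xdeg_leC; rewrite size_polyXn.
apply: xdeg_leM.
  rewrite addrK -mul_polyC -[w]addn0; apply: xdeg_leM; last by apply: xdeg_le_varY.
  by apply: xdeg_leC; rewrite size_polyXn addn0.
apply: xdeg_le_sum => i _.
have -> : (2 * w * v = 2 * w * (v.+1.-1 - i) + 2 * w * i)%N by have := ltn_ord i; nia.
apply: xdeg_leM; apply: xdeg_leXn; first exact: xdeg_le_base.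
by apply: xdeg_leC; rewrite size_frob_shift.
Qed.

Lemma xdeg_frob_ypow v : (v < q)%N -> xdeg_le (w * (q.-1 + v)) (frob_ypow v).
Proof.
move=> vq; rewrite -[frob_ypow v](subrK (frob_ypow_lead v)%:P); apply: xdeg_leD.
  by apply: xdeg_leW (frob_ypow_leadP vq); rewrite leq_mul2l; lia.
by apply: xdeg_leC; rewrite size_frob_ypow_lead.
Qed.

Lemma size_frob_ypow v : (size (frob_ypow v) <= v.+1)%N.
Proof.
rewrite /frob_ypow mulrC mul_polyC (leq_trans (size_scale_leq _ _)) //.
apply: leq_trans (size_poly_exp_leq _ _) _; rewrite ltnS.
suff : (size ('X^w *: 'X + frob_shift%:P : {poly {poly k}})%R <= 2)%N by nia.
rewrite (leq_trans (size_polyD _ _)) // geq_max.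
rewrite (leq_trans (size_scale_leq _ _)) ?size_polyX //.
by rewrite (leq_trans (size_polyC_leq1 _)).
Qed.

Definition frob_mon_lead (l : nat) : {poly k} := 'X^(s * (l %/ q)) * frob_ypow_lead
  (l %% q).

Let modq l : (l %% q < q)%N. Proof. by rewrite ltn_mod; lia. Qed.

Lemma size_frob_mon_lead l : size (frob_mon_lead l) = (w * (q.-1 + l)).+1.
Proof.
rewrite /frob_mon_lead mulrC size_mulXn; last by rewrite -size_poly_gt0
  size_frob_ypow_lead.
rewrite size_frob_ypow_lead // addnS; congr _.+1.
rewrite {3}(divn_eq l q) /s; nia.
Qed.

Lemma xdeg_leXZ m n P : xdeg_le n P -> xdeg_le (m + n) ('X^m *: P : {poly {poly k}}).
Proof.
by move=> h; rewrite -mul_polyC; apply: xdeg_leM => //; apply: xdeg_leC; rewrite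
  size_polyXn.
Qed.

Lemma xdeg_le_XZ n P : xdeg_le n P -> xdeg_le n.+1 ('X *: P : {poly {poly k}}).
Proof. by move=> h; have := xdeg_leXZ 1 h; rewrite expr1. Qed.

(** Each factor Y in the expansion of [frob_ypow] replaces a factor
    [frob_shift], of degree 2 w, by X^w. So the dominant term of [frob_mon l] is
    a polynomial in X alone, and all other terms are smaller by a factor X^w.
    Its degree w (q - 1 + l) is a function of the pole order l. *)
Lemma frob_mon_leadP l : xdeg_le (w * (q.-2 + l)) (frob_mon l - (frob_mon_lead l)%:P).
Proof.
rewrite /frob_mon /frob_mon_lead polyCM mul_polyC -scalerBr.
have -> : (w * (q.-2 + l) = s * (l %/ q) + w * (q.-2 + l %% q))%N.
  by rewrite {1}(divn_eq l q) /s; nia.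
by apply: xdeg_leXZ; apply: frob_ypow_leadP.
Qed.

Lemma xdeg_frob_mon l : xdeg_le (w * (q.-1 + l)) (frob_mon l).
Proof.
have -> : (w * (q.-1 + l) = s * (l %/ q) + w * (q.-1 + l %% q))%N.
  by rewrite {1}(divn_eq l q) /s; nia.
by apply: xdeg_leXZ; apply: xdeg_frob_ypow.
Qed.

Lemma size_frob_mon l : (size (frob_mon l) <= q)%N.
Proof.
by rewrite /frob_mon (leq_trans (size_scale_leq _ _)) // (leq_trans (size_frob_ypow _)).
Qed.

Lemma size_mon l : (size (mon l) <= q)%N.
Proof.
by rewrite /mon (leq_trans (size_scale_leq _ _)) // size_polyXn.
Qed.

Lemma xdeg_mon l : xdeg_le (l %/ q) (mon l).
Proof. by rewrite /mon -[X in xdeg_le X]addn0; apply: xdeg_leXZ; apply: xdeg_leX. Qed.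

Lemma xdeg_reduce n P : xdeg_le n P -> xdeg_le n.+2 (reduce P).
Proof.
move=> hP; apply: xdeg_leD.
  apply: (@xdeg_leW _ n.+1) => //; apply: xdeg_le_XZ => j.
  by rewrite coef_take_poly; case: ifP => // _; rewrite size_poly0.
rewrite -[n.+2]/(2 + n)%N; apply: xdeg_leM; last first.
  by move=> j; rewrite coef_drop_poly.
apply: xdeg_leD.
  by apply: (@xdeg_leW _ 1) => //; apply: xdeg_le_XZ; apply: xdeg_le_varY.
apply: xdeg_leC; rewrite /curve_rhs (leq_trans (size_polyD _ _)) // geq_max.
rewrite (leq_trans (size_polyC_leq1 _)) // andbT (leq_trans (size_polyD _ _)) //
  geq_max.
by rewrite size_polyXn size_polyN (leq_trans (size_scale_leq _ _)) ?size_polyX.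
Qed.

Lemma size_reduce (P : {poly {poly k}}) : (size P <= (2 * q).-1)%N -> (size (reduce
  P) <= q)%N.
Proof.
move=> hP; rewrite (leq_trans (size_polyD _ _)) // geq_max; apply/andP; split.
  by rewrite (leq_trans (size_scale_leq _ _)) // size_take_poly.
apply: leq_trans (size_polyMleq _ _) _; rewrite size_drop_poly.
suff : (size ('X *: 'X + curve_rhs%:P : {poly {poly k}})%R <= 2)%N by lia.
rewrite (leq_trans (size_polyD _ _)) // geq_max.
rewrite (leq_trans (size_scale_leq _ _)) ?size_polyX //.
by rewrite (leq_trans (size_polyC_leq1 _)).
Qed.

Lemma reduce_small (P : {poly {poly k}}) : (size P <= q)%N -> reduce P = 'X *: P.
Proof. by move=> h; rewrite /reduce take_poly_id // drop_poly_eq0 // mulr0 addr0. Qed.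

(** The X-degrees of the [frob_mon l] for distinct l are at least w apart.
    Multiplying by b l, of X-degree at most w - 2, and reducing does not close
    this gap, so the nonzero term of largest index cannot be cancelled. *)
Lemma reduce_combination_inj L (b : nat -> {poly {poly k}}) :
  (forall l, (l < L)%N -> (size (b l) <= q)%N) ->
  (forall l, (l < L)%N -> xdeg_le (w - 2) (b l)) ->
  \sum_(l < L) reduce (b l * frob_mon l) = 0 -> forall l, (l < L)%N -> b l = 0.
Proof.
elim: L => // L IH sb xb; rewrite big_ord_recr /= => sum0.
have bL : b L = 0.
  apply/eqP; rewrite -size_poly_eq0; apply/negP => /negP bL0.
  have hsmall : xdeg_le (w * (q.-1 + L)) ('X *: ((frob_mon_lead L) *: b L)).
    have -> : 'X *: (frob_mon_lead L *: b L) = - \sum_(l < L) reduce (b l * frob_mon l)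
              - reduce (b L * (frob_mon L - (frob_mon_lead L)%:P)).
      rewrite mulrBr -[_ - _]/(_ + - _) reduceD.
      have -> : reduce (- (b L * (frob_mon_lead L)%:P)) = - 'X *: (frob_mon_lead L *:
        b L).
        by rewrite mulrC mul_polyC -[- _]scaleN1r reduceZ reduce_small ?scaleN1r
          ?scaleNr // (leq_trans (size_scale_leq _ _)) // sb.
      move/eqP: (sum0); rewrite addr_eq0 => /eqP ->.
      by rewrite scaleNr opprK opprB addrCA subrr addr0.
    apply: xdeg_leD; apply: xdeg_leN.
      apply: xdeg_le_sum => l _.
      apply: (@xdeg_leW _ (w - 2 + w * (q.-1 + l)).+2); first by have := ltn_ord l; nia.
      by apply: xdeg_reduce; apply: xdeg_leM (xdeg_frob_mon l); apply: xb; rewrite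
        ltnS ltnW.
    apply: (@xdeg_leW _ (w - 2 + w * (q.-2 + L)).+2); first by nia.
    by apply: xdeg_reduce; apply: xdeg_leM (frob_mon_leadP L); apply: xb.
  have [j bLj] : exists j, (b L)`_j != 0.
    by exists (size (b L)).-1; rewrite -/(lead_coef (b L)) lead_coef_eq0 -size_poly_eq0.
  have := hsmall j; rewrite !coefZ -['X]expr1 mulrC size_mulXn; last first.
    by rewrite mulf_neq0 // -size_poly_gt0 size_frob_mon_lead.
  rewrite size_mul // -?size_poly_gt0 ?size_frob_mon_lead //.
  move: bLj; rewrite -size_poly_gt0; move: (size _) (w * _)%N => x1 x2; lia.
move=> l; rewrite ltnS leq_eqVlt => /predU1P [-> //|lL].
apply: IH lL => [l' lL|l' lL|]; rewrite ?sb ?ltnS ?(ltnW lL) //.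
  by apply: xb; rewrite ltnS ltnW.
have r0 : reduce 0 = 0 by have := reduceZ 0 0; rewrite !scale0r.
by move: sum0; rewrite bL mul0r r0 addr0.
Qed.

Let N := (q * (w - 1))%N.
Let L := (q * w.+1)%N.

Lemma card_pow_fix (x : k) : (x ^+ s) ^+ s = x.
Proof. by rewrite -exprM mulnn -card_k expf_card. Qed.

Lemma s_pchar : [pchar k].-nat s. Proof. by rewrite s_pow pchar_pow. Qed.

Lemma s_sum (I : Type) (t : seq I) (P : pred I) (F : I -> k) :
  (\sum_(i <- t | P i) F i) ^+ s = \sum_(i <- t | P i) F i ^+ s.
Proof.
apply: (big_morph (fun x => x ^+ s)) => [x y|]; first by rewrite exprDn_pchar ?s_pchar.
by rewrite expr0n /s; case: eqP => //; have := w_gt0; nia.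
Qed.

Lemma mon_free (c : 'I_N -> k) : \sum_(l < N) (c l)%:P *: mon l = 0 -> forall l, c l
  = 0.
Proof.
move=> sum0 l; have := congr1 (fun P : {poly {poly k}} => (P`_(l %% q))`_(l %/ q)) sum0.
rewrite !coef0 => <-; rewrite !coef_sum (bigD1 l) //= big1 => [|l' l'l].
  by rewrite addr0 /mon !coefZ coefCM coefXn eqxx mulr1 coefXn eqxx mulr1.
rewrite /mon !coefZ coefCM coefXn; case: eqP => hm; last by rewrite mulr0 coef0 mulr0.
rewrite mulr1 coefXn; case: eqP => hd; last by rewrite mulr0.
by case/eqP: l'l; apply: val_inj; rewrite /= (divn_eq l' q) -hm -hd -divn_eq.
Qed.

(** Linear algebra: there are q (w - 1) * q (w + 1) unknowns, and at most
    q (w s - w + 3) coefficients to annihilate. The hypothesis q + 3 < w says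
    exactly that there are more unknowns than equations. *)
Lemma aux_relation : exists2 C : 'I_N * 'I_L -> k, (exists i, C i != 0) &
  \sum_i (C i)%:P *: reduce (frob_mon i.1 * mon i.2) = 0.
Proof.
pose E := (w * s - w + 3)%N.
pose f (i : 'I_N * 'I_L) (j : 'I_q * 'I_E) : k :=
  ((reduce (frob_mon i.1 * mon i.2))`_(j.1))`_(j.2).
have [|C C0 hC] := @exists_nonzero_solution _ _ _ f.
  rewrite !card_prod !card_ord /N /L /E /s; nia.
exists C => //; apply/polyP => j; rewrite coef0 coef_sum.
apply/polyP => i; rewrite coef0 coef_sum.
under eq_bigr => l _ do rewrite coefZ coefCM.
have [jq|jq] := ltnP j q; last first.
  apply: big1 => l _; suff -> : (reduce (frob_mon l.1 * mon l.2))`_j = 0 by rewrite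
    coef0 mulr0.
  apply: nth_default; apply: leq_trans jq; apply: size_reduce.
  rewrite (leq_trans (size_polyMleq _ _)) //.
  by have := size_frob_mon l.1; have := size_mon l.2; lia.
have [iE|iE] := ltnP i E; first exact: (hC (Ordinal jq, Ordinal iE)).
apply: big1 => l _; rewrite nth_default ?mulr0 //; apply: leq_trans iE.
have := xdeg_reduce (xdeg_leM (xdeg_frob_mon l.1) (xdeg_mon l.2)) j.
move=> /leq_trans; apply.
have l2 : (l.2 %/ q <= w)%N.
  by rewrite -ltnS ltn_divLR; [rewrite mulnC; exact: ltn_ord|lia].
have l1 := ltn_ord l.1; rewrite /E /s; rewrite /N in l1.
move: (nat_of_ord l.1) l1 => n1 l1; move: (l.2 %/ q)%N l2 => n2 l2.
have : (w * (q.-1 + n1) <= w * (q * w - 2))%N by rewrite leq_mul2l; nia.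
have : (w * 2 <= w * (q * w))%N by rewrite leq_mul2l; nia.
by rewrite mulnBr; move: (w * (q * w))%N (w * (q.-1 + n1))%N => x1 x2; lia.
Qed.

(** Write z_l for the value of [mon l] at a rational point. By [aux_relation]
    some sum of C_(m,l) z_m^s z_l vanishes on the curve. Let c^s = C. As
    z^(s^2) = z in k, this sum is the s-th power of the sum G of the
    c_(m,l) z_m z_l^s, so G vanishes at all rational points. By
    [reduce_combination_inj], G is not identically zero on the curve; reduced to
    Y-degree below q, its coefficients vanish at all x above which there is a
    rational point, and their degree, of order s^2 / q, bounds the number of
    these x. *)
Theorem stepanov_bound :
  (#|[set x | [exists y, on_curve x y]]| <= w * s + 2 * s)%N.
Proof.
have [C [i0 Ci0] hC] := aux_relation.
(* The Frobenius map x -> x^s is an involution of k, so C^s is an s-th root of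
   C. *)
pose c i := C i ^+ s.
have cC i : c i ^+ s = C i by exact: card_pow_fix.
pose Psi := \sum_i (c i)%:P *: reduce (mon i.1 * frob_mon i.2).
have Psi0 : Psi != 0.
  apply/negP => /eqP Psi0.
  pose b l := if (insub l : option 'I_L) is Some l' then
     \sum_(m < N) (c (m, l'))%:P *: mon m else 0.
  have bE (l : 'I_L) : b l = \sum_(m < N) (c (m, l))%:P *: mon m by rewrite /b valK.
  have bz l : (l < L)%N -> b l = 0.
    move: l; apply: reduce_combination_inj => [l lL|l lL|].
    - rewrite (bE (Ordinal lL)); apply: (leq_trans (size_sum _ _ _)).
      apply/bigmax_leqP => m _; apply: (leq_trans (size_scale_leq _ _)).
      exact: size_mon.
    - rewrite (bE (Ordinal lL)); apply: xdeg_le_sum => m _; apply: xdeg_leZ.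
      apply: xdeg_leW (xdeg_mon _).
      have : (m %/ q < w - 1)%N.
        by rewrite ltn_divLR; [rewrite mulnC; exact: ltn_ord|lia].
      lia.
    - transitivity Psi => //.
      transitivity (\sum_m \sum_l (c (m, l))%:P *: reduce (mon m * frob_mon l)).
        rewrite exchange_big /=; apply: eq_bigr => l _; rewrite bE mulr_suml reduce_sum.
        by apply: eq_bigr => m _; rewrite -scalerAl reduceZ.
      by rewrite pair_bigA /Psi; apply: eq_bigr => i _; rewrite -surjective_pairing.
  have := bz _ (ltn_ord i0.2).
  rewrite bE => /mon_free/(_ i0.1) /eqP; rewrite -surjective_pairing /c.
  by rewrite expf_eq0 (negPf Ci0) andbF.
have ev0 x y : on_curve x y -> eval2 x y Psi = 0.
  move=> hxy; have x0 : x != 0 by case/andP: hxy.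
  have rel0 : \sum_i C i * (eval2 x y (mon i.1) ^+ s * eval2 x y (mon i.2)) = 0.
    have : x * x ^+ (w * q.-1) != 0 by rewrite mulf_neq0 ?expf_neq0.
    move/mulfI; apply; rewrite mulr0 -[RHS](_ : eval2 x y 0 = 0); last by rewrite
      /eval2 !horner0.
    rewrite -hC eval2_sum mulr_sumr; apply: eq_bigr => i _.
    by rewrite (eval2Z x y (C i)%:P) hornerC (eval2_reduce _ hxy) eval2M
      (eval2_frob_mon _ hxy); ring.
  have : (\sum_i c i * (eval2 x y (mon i.1) * eval2 x y (mon i.2) ^+ s)) ^+ s = 0.
    rewrite s_sum -[RHS]rel0; apply: eq_bigr => i _.
    by rewrite !exprMn cC card_pow_fix.
  move/eqP; rewrite expf_eq0 => /andP [_ /eqP G0].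
  transitivity (x * x ^+ (w * q.-1) *
      \sum_i c i * (eval2 x y (mon i.1) * eval2 x y (mon i.2) ^+ s)).
    rewrite /Psi eval2_sum mulr_sumr; apply: eq_bigr => i _.
    by rewrite (eval2Z x y (c i)%:P) hornerC (eval2_reduce _ hxy) eval2M
      (eval2_frob_mon _ hxy); ring.
  by rewrite G0 mulr0.
have size_Psi : (size Psi <= q)%N.
  apply: (leq_trans (size_sum _ _ _)); apply/bigmax_leqP => i _.
  apply: (leq_trans (size_scale_leq _ _)); apply: size_reduce.
  rewrite (leq_trans (size_polyMleq _ _)) //.
  by have := size_frob_mon i.2; have := size_mon i.1; lia.
have xdeg_Psi : xdeg_le (w * s + 2 * s) Psi.
  apply: xdeg_le_sum => i _; apply: xdeg_leZ.
  apply: xdeg_leW (xdeg_reduce (xdeg_leM (xdeg_mon i.1) (xdeg_frob_mon i.2))).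
  have l1 : (i.1 %/ q < w - 1)%N by rewrite ltn_divLR; [rewrite mulnC; exact:
    ltn_ord|lia].
  have l2 := ltn_ord i.2; rewrite /L in l2.
  move: (nat_of_ord i.2) l2 => n1 l2; move: (i.1 %/ q)%N l1 => n2 l1.
  have : (w * (q.-1 + n1) <= w * (q * w + 2 * q - 2))%N by rewrite leq_mul2l; nia.
  have : (w * 2 <= w * (q * w + 2 * q))%N by rewrite leq_mul2l; nia.
  have -> : (w * s + 2 * s = w * (q * w + 2 * q))%N by rewrite /s; ring.
  by rewrite mulnBr; move: (w * (_ + _))%N (w * (q.-1 + n1))%N => x1 x2; lia.
have [j Pj] : exists j, Psi`_j != 0.
  by exists (size Psi).-1; rewrite -/(lead_coef _) lead_coef_eq0.
have rootPj x y : on_curve x y -> root Psi`_j x.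
  move=> hxy; pose P := map_poly (horner_eval x) Psi.
  have sP : (size P <= q)%N by apply: leq_trans (size_poly _ _) _.
  have P0 : P = 0.
    apply/eqP; apply/negP => /negP P0.
    (* The q points above x are zeros of a polynomial in Y of degree below q. *)
    pose rs := [seq y + c | c <- enum [set c : k | c ^+ q == c]].
    have : (size rs < size P)%N.
      apply: max_poly_roots P0 _ _.
        apply/allP => _ /mapP [d dF ->]; rewrite mem_enum inE in dF.
        have hd : on_curve x (y + d).
          case/andP: hxy => x0 /eqP h; rewrite /on_curve x0 /= -h.
          rewrite exprDn_pchar // (eqP dF); apply/eqP; ring.
        apply/eqP; rewrite -[RHS](ev0 _ _ hd) /P -[X in _.[X]](hornerC _ x).
        exact: (horner_map (horner_eval x) Psi (y + d)%:P).
      by rewrite map_inj_uniq ?enum_uniq //; apply: addrI.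
    by rewrite size_map -cardE ltnNge (leq_trans sP).
  have := congr1 (fun P : {poly k} => P`_j) P0.
  by rewrite coef0 coef_map /= /root => /eqP.
rewrite cardE -ltnS; apply: leq_trans (xdeg_Psi j).
apply: max_poly_roots Pj _ (enum_uniq _); apply/allP => x.
by rewrite mem_enum inE => /existsP [y]; exact: rootPj.
Qed.

End Stepanov.

(** * Additive characters and Kloosterman sums *)

Section AddChar.
Variable k : finFieldType.

Definition additive_char (psi : k -> algC) :=
  (psi 0 = 1) /\ (forall x y, psi (x + y) = psi x * psi y).

(** The sum of all elements of k is invariant under the translation by 1. *)
Lemma card_natr0 : #|k|%:R = 0 :> k.
Proof.
have h : \sum_(x : k) x = \sum_(x : k) (x + 1) by rewrite [LHS](reindex_inj (addIr 1)).
move/eqP: h; rewrite big_split /= -subr_eq0 opprD addrA subrr sub0r oppr_eq0 => /eqP.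
by rewrite sumr_const.
Qed.

Variable psi : k -> algC.
Hypothesis psiP : additive_char psi.

Lemma psi0 : psi 0 = 1. Proof. by case: psiP. Qed.
Lemma psiD x y : psi (x + y) = psi x * psi y. Proof. by case: psiP. Qed.

Lemma psi_norm x : `|psi x| = 1.
Proof.
have psiX n : psi (x *+ n) = psi x ^+ n.
  by elim: n => [|n IH]; rewrite ?mulr0n ?psi0 // mulrS psiD IH exprS.
have : `|psi x| ^+ #|k| == 1.
  by rewrite -normrX -psiX -mulr_natr card_natr0 mulr0 psi0 normr1.
rewrite pexpr_eq1 ?normr_ge0 // => [/eqP //|].
by rewrite lt0n; apply/pred0Pn; exists 0.
Qed.

Lemma psi_neq0 x : psi x != 0.
Proof. by rewrite -normr_eq0 psi_norm oner_eq0. Qed.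

Lemma psiN x : psi (- x) = (psi x)^-1.
Proof. by apply: (mulfI (psi_neq0 x)); rewrite -psiD subrr psi0 mulfV ?psi_neq0. Qed.

Lemma psi_conj x : (psi x)^* = psi (- x).
Proof.
by rewrite psiN invC_norm psi_norm expr1n invr1 mul1r.
Qed.

Hypothesis psi_nontriv : exists x, psi x != 1.

Lemma sum_psi : \sum_x psi x = 0.
Proof.
have [u pu] := psi_nontriv.
have : psi u * \sum_x psi x = \sum_x psi x.
  rewrite mulr_sumr [RHS](reindex_inj (addrI u)) /=.
  by apply: eq_bigr => x _; rewrite psiD.
move/eqP; rewrite -subr_eq0 -{2}[\sum_x _]mul1r -mulrBl mulf_eq0 subr_eq0.
by rewrite (negPf pu) => /eqP.
Qed.

Lemma sum_psi_mul b : \sum_x psi (b * x) = if b == 0 then #|k|%:R else 0.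
Proof.
case: eqP => [->|/eqP b0].
  under eq_bigr do rewrite mul0r psi0.
  by rewrite sumr_const.
by rewrite -[RHS]sum_psi [RHS](reindex_inj (mulfI b0)).
Qed.

End AddChar.

Definition kloosterman (k : finFieldType) (psi : k -> algC) (a : k) : algC :=
  \sum_(x | x != 0) psi (x + a / x).

Section KloostermanStepanov.
Variables (k : finFieldType) (q r : nat) (a : k) (psi : k -> algC).
Hypothesis q_gt1 : (1 < q)%N.
Hypothesis q_pchar : [pchar k].-nat q.
Let w := (q ^ r)%N.
Let s := (q * w)%N.
Hypothesis w_big : (q + 3 < w)%N.
Hypothesis card_k : #|k| = (s ^ 2)%N.
Hypothesis fix_q : (q <= #|[set c : k | c ^+ q == c]|)%N.
Hypothesis psiP : additive_char psi.
Hypothesis psi_nontriv : exists x, psi x != 1.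
Hypothesis psi_q : forall x, psi (x ^+ q) = psi x.

Lemma card_fiber (v : k) : (#|[pred y : k | (y ^+ q - y == v)%R]| <= q)%N.
Proof.
pose P : {poly k} := 'X^q - ('X + v%:P).
have sP : size P = q.+1.
  rewrite size_polyDl ?size_polyXn // size_polyN size_XaddC; lia.
have P0 : P != 0 by rewrite -size_poly_gt0 sP.
rewrite cardE -ltnS -sP; apply: max_poly_roots P0 _ (enum_uniq _).
apply/allP => y; rewrite mem_enum inE => /eqP hv; apply/eqP.
by rewrite /P !(hornerD, hornerN, hornerX, hornerXn, hornerC) -hv; ring.
Qed.

Let card_curve e := #|[pred p : k * k | on_curve q a e p.1 p.2]|.

Lemma card_curve_le e : (card_curve e <= q * (w * s + 2 * s))%N.
Proof.
have := stepanov_bound a e q_gt1 q_pchar w_big card_k fix_q.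
rewrite -/w -/s => hS; rewrite /card_curve -sum1_card.
rewrite -(pair_big_dep predT (fun x y => on_curve q a e x y) (fun _ _ => 1%N)) /=.
apply: leq_trans (leq_mul (leqnn q) hS); rewrite mulnC -sum_nat_const.
rewrite (bigID (mem [set x | [exists y, on_curve q a e x y]])) /=.
rewrite [X in (_ + X)%N]big1 => [|x]; last first.
  rewrite inE negb_exists => /forallP hx; apply: big1 => y hxy.
  by have := hx y; rewrite hxy.
rewrite addn0; apply: leq_sum => x _.
apply: leq_trans (card_fiber (x + a / x - e)); rewrite -sum1_card.
rewrite [X in (_ <= X)%N](bigID (fun y => on_curve q a e x y)) /=.
apply: leq_trans (leq_addr _ _); apply: eq_leq; apply: eq_bigl => y.
by rewrite /on_curve; case: (x != 0); rewrite ?andbF ?andbT //= inE andbb.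
Qed.

(** Let N(e) be the number of rational points (x, y) of the curve with parameter
    e. As psi is trivial on the elements y^q - y, |k| K is the sum of the
    psi(e) N(e). The psi(e) sum to 0, so that N(e) may be replaced by N(e) - B
    for any constant B. If B is an upper bound for all N(e), then the absolute
    value is at most the sum of the B - N(e), which is known exactly because each
    pair (x, y) with x <> 0 lies on one curve. Thus upper bounds for the N(e)
    suffice. *)
Lemma kloosterman_stepanov : `|kloosterman psi a| <= (2 * q * s + 1)%:R.
Proof.
pose g (p : k * k) := p.1 + a / p.1 - (p.2 ^+ q - p.2).
have ocE e p : on_curve q a e p.1 p.2 = (p.1 != 0) && (g p == e).
  rewrite /on_curve /g; congr (_ && _).
  by rewrite -subr_eq0 -[RHS]subr_eq0 -[RHS]oppr_eq0; congr (_ == 0); ring.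
have Qpos : (0 < #|k|)%N by apply/card_gt0P; exists 0.
have QK : #|k|%:R * kloosterman psi a = \sum_e psi e * (card_curve e)%:R.
  transitivity (\sum_(p : k * k | p.1 != 0) psi (g p)).
    transitivity (\sum_(x | x != 0) \sum_y psi (g (x, y))); last first.
      by rewrite pair_big; apply: eq_big => [p|p _] /=; rewrite ?andbT.
    rewrite mulr_sumr; apply: eq_bigr => x x0.
    have psig y : psi (g (x, y)) = psi (x + a / x).
      rewrite /g /= (psiD psiP (x + a / x)) (psiN psiP) (psiD psiP (y ^+ q)) psi_q.
      by rewrite (psiN psiP) divff ?psi_neq0 // invr1 mulr1.
    under [RHS]eq_bigr => y _ do rewrite psig.
    by rewrite sumr_const mulr_natl.
  rewrite (partition_big g predT) //=; apply: eq_bigr => e _.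
  rewrite (eq_bigr (fun=> psi e)) => [|p /andP [_ /eqP -> //]].
  rewrite sumr_const /card_curve -[LHS]mulr_natr; congr (_ * _%:R).
  by apply: eq_card => p; rewrite !inE ocE.
have sumN : \sum_e (card_curve e)%:R = (#|k| * (#|k| - 1))%:R :> algC.
  rewrite -natr_sum; congr (_%:R).
  transitivity (#|[pred p : k * k | p.1 != 0]|).
    rewrite -[RHS]sum1_card (partition_big g predT) //=; apply: eq_bigr => e _.
    rewrite /card_curve -sum1_card; apply: eq_bigl => p.
    by rewrite !inE ocE.
  transitivity (\sum_(x : k | (x != 0)%R) \sum_(y : k) 1)%N.
    by rewrite pair_big -sum1_card; apply: eq_bigl => p /=; rewrite andbT.
  under eq_bigr => x _ do rewrite sum1_card.
  rewrite sum_nat_const mulnC; congr (_ * _)%N.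
  by have := cardC1 (0 : k); rewrite subn1 => <-; apply: eq_card => x.
pose B := (q * (w * s + 2 * s))%N.
have Qn0 : (0 : algC) < #|k|%:R by rewrite ltr0n.
rewrite -(ler_pM2l Qn0) -[X in X * `|_|]normr_nat -normrM QK.
(* The constant B contributes nothing since the psi e sum to 0. *)
have -> : \sum_e psi e * (card_curve e)%:R = - \sum_e psi e * (B - card_curve e)%:R.
  apply/eqP; rewrite -addr_eq0 -big_split /=; apply/eqP.
  under eq_bigr => e _ do rewrite -mulrDr -natrD subnKC ?card_curve_le //.
  by rewrite -mulr_suml sum_psi ?mul0r.
rewrite normrN; apply: le_trans (ler_norm_sum _ _ _) _.
under eq_bigr => e _ do rewrite normrM psi_norm // mul1r normr_nat natrB
  ?card_curve_le //.
rewrite sumrB sumN sumr_const -[B%:R *+ _]mulr_natl -!natrM -natrB; last first.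
  rewrite leq_mul2l card_k; apply/orP; right; rewrite /B /s; nia.
rewrite ler_nat -mulnBr leq_mul2l card_k; apply/orP; right; rewrite /B /s.
nia.
Qed.
End KloostermanStepanov.

(** * Kloosterman sums in quadratic extensions *)

Lemma two_neq0 (k : finFieldType) : odd #|k| -> (2 : k) != 0.
Proof.
move=> ok; apply/negP => /eqP h; have := card_natr0 k.
rewrite -(odd_double_half #|k|) ok -muln2 natrD natrM h mulr0 addr0.
by move/eqP; rewrite oner_eq0.
Qed.

(** Squaring is not injective, as 1 and -1 have the same square, so it is not
    surjective either. *)
Lemma exists_nonsquare (k : finFieldType) : odd #|k| -> exists d : k, forall x, x ^+
  2 != d.
Proof.
move=> /two_neq0 n2; case: (pickP (fun d : k => [forall x, x ^+ 2 != d])) => [d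
  /forallP hd|h].
  by exists d.
have sq_surj (d : k) : exists x, x ^+ 2 == d.
  by have /negbT := h d; rewrite negb_forall => /existsP [x]; rewrite negbK; exists x.
pose f (d : k) := xchoose (sq_surj d).
have fK : cancel f (fun x => x ^+ 2) by move=> d; exact/eqP/(xchooseP (sq_surj d)).
have [g _ gK] := injF_bij (can_inj fK).
have : (1 : k) = -1.
  have e x : f (x ^+ 2) = x by rewrite -[in RHS](gK x) -[in LHS](gK x) fK.
  by rewrite -[LHS]e -[RHS]e sqrrN.
by move/eqP; rewrite -subr_eq0 opprK (negPf n2).
Qed.

Lemma quadratic_extension (k : finFieldType) : odd #|k| ->
  exists L : finFieldType, exists iota : {rmorphism k -> L}, #|L| = (#|k| ^ 2)%N.
Proof.
case/exists_nonsquare => d hd; pose p : {poly k} := 'X^2 - d%:P.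
have sp : size p = 3 by exact: size_XnsubC.
have p_mon : p \is monic by exact: monicXnsubC.
have irr : irreducible_poly p.
  apply: cubic_irreducible; first by rewrite sp.
  by move=> x; rewrite rootE !hornerE subr_eq0; exact: hd.
have mi : monic_irreducible_poly p by split.
pose L : finFieldType := {poly %/ p with mi}.
exists L; exists (@GRing.RMorphism.clone k L (qpolyC p) _).
by rewrite card_qfpoly sp.
Qed.

Lemma pchar_card (k : finFieldType) : [pchar k].-nat #|k|.
Proof.
have [p pp pk] := finPcharP k.
rewrite (eq_pnat _ (pcharf_eq pk)); have := fin_ring_pchar_abelem pk.
by move/abelem_pgroup; rewrite /pgroup cardsT.
Qed.

Section QuadraticLift.
Variables (k L : finFieldType) (iota : {rmorphism k -> L}).
Hypothesis card_L : #|L| = (#|k| ^ 2)%N.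
Let Q := #|k|.

Lemma Frob_iota x : iota x ^+ Q = iota x.
Proof. by rewrite -rmorphXn expf_card. Qed.

Lemma pchar_Q : [pchar L].-nat Q.
Proof. by rewrite (eq_pnat _ (fmorph_pchar iota)) pchar_card. Qed.

(** All the roots of X^Q - X are already in k. *)
Lemma fixed_in_image (z : L) : z ^+ Q = z -> exists x, iota x = z.
Proof.
move=> hz; have : root (map_poly iota ('X^Q - 'X)) z.
  by rewrite rmorphB /= map_polyXn map_polyX rootE !(hornerD, hornerN, hornerXn,
    hornerX) hz subrr.
rewrite finField_genPoly rmorph_prod /= /root horner_prod prodf_seq_eq0.
case/hasP => x _; rewrite rmorphB /= map_polyX map_polyC /= !hornerE subr_eq0 => /eqP
  ->.
by exists x.
Qed.

Definition descend (z : L) : k := odflt 0 [pick x | iota x == z].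

Lemma descendK z : z ^+ Q = z -> iota (descend z) = z.
Proof.
move/fixed_in_image => [x hx]; rewrite /descend; case: pickP => [y /eqP //|/(_ x)].
by rewrite hx eqxx.
Qed.

Lemma FrobFrob (z : L) : (z ^+ Q) ^+ Q = z.
Proof. by rewrite -exprM mulnn -card_L expf_card. Qed.

Lemma iota_inj : injective iota. Proof. exact: fmorph_inj. Qed.

Definition trL (z : L) : k := descend (z + z ^+ Q).
Definition nmL (z : L) : k := descend (z * z ^+ Q).

Lemma trLK z : iota (trL z) = z + z ^+ Q.
Proof. by rewrite descendK // exprDn_pchar ?pchar_Q // FrobFrob addrC. Qed.

Lemma nmLK z : iota (nmL z) = z * z ^+ Q.
Proof. by rewrite descendK // exprMn FrobFrob mulrC. Qed.

(** Only roots of X^2 - e1 X + e2 are counted here. If it has roots x and y in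
    k, then the pairs are (x, y) and (y, x), and some z occurs only if x = y,
    when both pairs coincide and z is the image of x. Otherwise there are no
    pairs, and z is one of two conjugate roots. *)
Lemma card_sum_prod_le (e1 e2 : k) :
  (#|[pred p : k * k | ((p.1 + p.2)%R == e1) && ((p.1 * p.2)%R == e2)]| +
   #|[pred z : L | (trL z == e1) && (nmL z == e2)]| <= 2)%N.
Proof.
set A := [pred p | _]; set B := [pred z | _].
have BP z : z \in B -> z + z ^+ Q = iota e1 /\ z * z ^+ Q = iota e2.
  by rewrite inE => /andP [/eqP <- /eqP <-]; rewrite trLK nmLK.
have vieta (R : finFieldType) (x y z t : R) : z + t = x + y -> z * t = x * y -> (z ==
  x) || (z == y).
  move=> h1 h2; rewrite -(subr_eq0 z x) -(subr_eq0 z y) -mulf_eq0.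
  have -> : (z - x) * (z - y) = z * (z + t) - z * (x + y) - (z * t - x * y) by ring.
  by rewrite h1 h2 !subrr.
have card_le1 (T : finType) (S : pred T) x : {subset S <= pred1 x} -> (#|S| <= 1)%N.
  by move=> h; rewrite -(card1 x); apply/subset_leq_card/subsetP.
have card_le2 (T : finType) (S : pred T) x y : {subset S <= pred2 x y} -> (#|S| <= 2)%N.
  by move=> h; apply: leq_trans (subset_leq_card (introT subsetP h)) _; rewrite
    card2; case: (_ != _).
case: (pickP A) => [[x y] /= /andP [/eqP h1 /eqP h2]|A0]; last first.
  rewrite (eq_card0 A0) add0n; case: (pickP B) => [z0 Bz0|B0]; last by rewrite
    (eq_card0 B0).
  apply: (card_le2 _ _ z0 (z0 ^+ Q)) => z /BP [t1 t2]; have [u1 u2] := BP _ Bz0.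
  by apply: (vieta _ _ _ _ (z ^+ Q)); rewrite ?t1 ?t2.
have AP p : p \in A -> (p == (x, y)) || (p == (y, x)).
  case: p => x' y'; rewrite inE /= => /andP [/eqP t1 /eqP t2].
  have /orP [] := @vieta k x y x' y' (etrans t1 (esym h1)) (etrans t2 (esym h2)) =>
    /eqP ex.
    have -> : y' = y by apply: (addrI x); rewrite h1 -t1 ex.
    by rewrite ex eqxx.
  have -> : y' = x by apply: (addIr y); rewrite h1 -t1 ex addrC.
  by rewrite ex eqxx orbT.
have BP' z : z \in B -> x = y /\ z = iota x.
  move=> /BP [t1 t2]; rewrite -h1 -h2 rmorphD rmorphM in t1 t2.
  have aux u v : iota u + iota v = z + z ^+ Q -> z = iota u -> u = v /\ z = iota u.
    by move=> h zu; split=> //; move: h; rewrite zu Frob_iota => /addrI /iota_inj.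
  have /orP [/eqP zx|/eqP zy] := vieta _ _ _ _ _ t1 t2.
    by apply: aux; rewrite ?t1.
  have [|yx zy'] := aux y x _ zy; first by rewrite addrC t1.
  by rewrite -{2}yx.
case: (pickP B) => [z0 Bz0|B0]; last by rewrite (eq_card0 B0) addn0; exact: (card_le2
  _ _ (x, y) (y, x)).
have [xy _] := BP' _ Bz0.
rewrite -[2%N]/(1 + 1)%N leq_add //.
  by apply: (card_le1 _ _ (x, x)) => p /AP; rewrite -xy orbb.
by apply: (card_le1 _ _ (iota x)) => z /BP' [_ ->]; exact: eqxx.
Qed.

Let cA e := #|[pred p : k * k | (p.1 + p.2 == e.1) && (p.1 * p.2 == e.2)]|.
Let cB e := #|[pred z : L | (trL z == e.1) && (nmL z == e.2)]|.

(** The pairs (x, y) and the elements z both number |k|^2 in total, and there are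
    |k|^2 values of (e1, e2); so the upper bound 2 is an equality throughout. *)
Lemma card_sum_prod (e : k * k) : (cA e + cB e = 2)%N.
Proof.
have sumA : (\sum_e cA e = Q ^ 2)%N.
  transitivity #|{: k * k}|; last by rewrite card_prod mulnn.
  rewrite -[RHS]sum1_card [RHS](partition_big (fun p => (p.1 + p.2, p.1 * p.2))
    predT) //=.
  by apply: eq_bigr => e' _; rewrite /cA /cB -sum1_card; apply: eq_bigl => p; rewrite
    inE -xpair_eqE -surjective_pairing.
have sumB : (\sum_e cB e = Q ^ 2)%N.
  rewrite -card_L -[RHS]sum1_card [RHS](partition_big (fun z => (trL z, nmL z))
    predT) //=.
  by apply: eq_bigr => e' _; rewrite /cA /cB -sum1_card; apply: eq_bigl => z; rewrite
    inE -xpair_eqE -surjective_pairing.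
(* The defects 2 - (cA + cB) are nonnegative and sum to 0. *)
have le2 e' : (cA e' + cB e' <= 2)%N by apply: card_sum_prod_le.
have : (\sum_e' (2 - (cA e' + cB e')) = 0)%N.
  rewrite sumnB // big_split /= sumA sumB sum_nat_const card_prod.
  by rewrite mulnn mulnC mul2n addnn subnn.
by move/eqP; rewrite sum_nat_eq0 => /forallP /(_ e) /= /eqP; have := le2 e; lia.
Qed.

Variables (psi : k -> algC) (a : k).
Hypothesis psiP : additive_char psi.
Hypothesis psi_nontriv : exists x, psi x != 1.
Hypothesis a0 : a != 0.

Definition liftchar (z : L) := psi (trL z).

Lemma trLD z1 z2 : trL (z1 + z2) = trL z1 + trL z2.
Proof.
apply: iota_inj; rewrite rmorphD !trLK exprDn_pchar ?pchar_Q //.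
by rewrite addrACA.
Qed.

Lemma liftchar_char : additive_char liftchar.
Proof.
split=> [|x y]; last by rewrite /liftchar trLD (psiD psiP).
rewrite /liftchar; have -> : trL 0 = 0; last exact: psi0.
by apply: (addrI (trL 0)); rewrite -trLD !addr0.
Qed.

Lemma trL_iota x : trL (iota x) = x + x.
Proof. by apply: iota_inj; rewrite trLK Frob_iota rmorphD. Qed.

Lemma liftchar_nontriv : odd #|k| -> exists z, liftchar z != 1.
Proof.
move=> /two_neq0 n2; have [x hx] := psi_nontriv; exists (iota (x / 2)).
rewrite /liftchar trL_iota; suff -> : x / 2 + x / 2 = x by [].
by field.
Qed.

Lemma liftchar_pow q : [pchar k].-nat q -> (forall x, psi (x ^+ q) = psi x) ->
  forall z, liftchar (z ^+ q) = liftchar z.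
Proof.
move=> qk hq z; rewrite /liftchar -[RHS]hq; congr psi; apply: iota_inj.
rewrite rmorphXn !trLK exprDn_pchar; first by rewrite exprAC.
by rewrite (eq_pnat _ (fmorph_pchar iota)).
Qed.

(** The terms of K^2 depend only on the sum e1 and the product e2 of two
    elements of k, and those of the sum over L in the same way on the trace and
    the norm: both are psi(e1 (1 + a / e2)). By [card_sum_prod] the two sums add
    up to twice the sum of this over e1 and e2 <> 0, in which the sum over e1
    vanishes unless e2 = -a. *)
Lemma hasse_davenport :
  kloosterman liftchar (iota a) = 2 * Q%:R - kloosterman psi a ^+ 2.
Proof.
pose F (e : k * k) := psi (e.1 * (1 + a / e.2)).
have hA : kloosterman psi a ^+ 2 = \sum_(e : k * k | e.2 != 0) F e *+ cA e.
  rewrite expr2 /kloosterman big_distrlr /= pair_big /=.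
  rewrite (partition_big (fun p => (p.1 + p.2, p.1 * p.2)) (fun e => e.2 != 0)) /= =>
    [|p /andP [h1 h2]]; last by rewrite mulf_neq0.
  apply: eq_bigr => e e0.
  have pr (p : k * k) : (p.1 != 0) && (p.2 != 0) && ((p.1 + p.2, p.1 * p.2) == e) =
    (p.1 + p.2 == e.1) && (p.1 * p.2 == e.2).
    rewrite [e]surjective_pairing xpair_eqE /= -negb_or -mulf_eq0; case: (p.1 * p.2
      =P e.2) => [->|]; rewrite ?e0 ?andbF //.
  rewrite (eq_bigl _ _ pr) (eq_bigr (fun=> F e)) ?sumr_const // => p /andP [/eqP h1
    /eqP h2].
  rewrite -(psiD psiP) /F -h1 -h2; congr psi.
  have : p.1 * p.2 != 0 by rewrite h2.
  by rewrite mulf_eq0 negb_or => /andP [u v]; field; rewrite u v.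
have hB : kloosterman liftchar (iota a) = \sum_(e : k * k | e.2 != 0) F e *+ cB e.
  have nm0 z : (nmL z != 0) = (z != 0).
    by rewrite -(fmorph_eq0 iota) nmLK mulf_eq0 expf_eq0; case: (z == 0); rewrite
      ?andbF.
  rewrite /kloosterman.
  rewrite (partition_big (fun z => (trL z, nmL z)) (fun e => e.2 != 0)) /= => [|z];
    last by rewrite nm0.
  apply: eq_bigr => e e0.
  have pr z : (z != 0) && ((trL z, nmL z) == e) = (trL z == e.1) && (nmL z == e.2).
    rewrite [e]surjective_pairing xpair_eqE /= -nm0; case: (nmL z =P e.2) => [->|];
      rewrite ?e0 ?andbF //.
  rewrite (eq_bigl _ _ pr) (eq_bigr (fun=> F e)) ?sumr_const // => z /andP [/eqP h1
    /eqP h2].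
  rewrite /liftchar /F -h1 -h2; congr psi; apply: iota_inj.
  rewrite trLK rmorphM rmorphD rmorph1 fmorph_div trLK nmLK.
  have z0 : z != 0 by rewrite -nm0 h2.
  have zQ0 : z ^+ Q != 0 by rewrite expf_neq0.
  rewrite exprDn_pchar ?pchar_Q // exprMn exprVn Frob_iota.
  by field; rewrite z0 zQ0.
apply/eqP; rewrite eq_sym subr_eq hA hB -big_split /=; apply/eqP.
under [RHS]eq_bigr => e _ do rewrite -mulrnDr addnC card_sum_prod.
rewrite sumrMnl -[RHS]mulr_natl; congr (_ * _); symmetry.
transitivity (\sum_(e2 | e2 != 0) \sum_e1 psi (e1 * (1 + a / e2))).
  rewrite exchange_big /= pair_big /=; apply: eq_bigl => e; by rewrite /=.
rewrite (bigD1 (- a)) ?oppr_eq0 //= [X in _ + X]big1 => [|e2 /andP [e20 e2a]].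
  rewrite addr0 invrN mulrN divff // subrr.
  by under eq_bigr do rewrite mulr0 (psi0 psiP); rewrite sumr_const.
under eq_bigr => e1 _ do rewrite mulrC.
rewrite sum_psi_mul //; case: eqP => // h.
case/negP: e2a; rewrite -addr_eq0.
have -> : e2 + a = e2 * (1 + a / e2) by field.
by rewrite h mulr0.
Qed.

End QuadraticLift.

(** * Weil's bound for Kloosterman sums *)

Section Weil.
Variables (F : finFieldType) (psi : F -> algC) (a : F).
Hypothesis oddF : odd #|F|.
Hypothesis psiP : additive_char psi.
Hypothesis psi_nontriv : exists x, psi x != 1.
Hypothesis a0 : a != 0.
Let q := #|F|.

(** If |K|^2 >= (4 + e) |k|, then [hasse_davenport] gives |K_L| >= (2 + e) |k|,
    so that |K_L|^2 >= (4 + 4 e) |L|. *)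
Lemma kloosterman_amplification (delta : algC) : 0 <= delta ->
  (4 + delta) * q%:R <= `|kloosterman psi a| ^+ 2 ->
  forall j, exists (k : finFieldType) (iota : {rmorphism F -> k}) (psik : k -> algC)
    (b : k),
   [/\ #|k| = (q ^ (2 ^ j))%N, additive_char psik, exists x, psik x != 1,
       forall x, psik (x ^+ q) = psik x &
     b != 0 /\ (4 + 4 ^+ j * delta) * #|k|%:R <= `|kloosterman psik b| ^+ 2].
Proof.
move=> d0 hd; elim=> [|j [k [iota [psik [b [ck chk ntk frk [b0 hk]]]]]]].
  exists F, (GRing.RMorphism.clone _ _ (@idfun F) _), psi, a; split=> //.
    by move=> x; rewrite expf_card.
  by rewrite expr0 mul1r.
have oddk : odd #|k| by rewrite ck oddX oddF orbT.
have [L [i2 cL]] := quadratic_extension oddk.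
exists L, (GRing.RMorphism.clone _ _ (i2 \o iota) _), (liftchar i2 psik), (i2 b); split.
- by rewrite cL ck -expnM expnS mulnC.
- exact: liftchar_char.
- exact: liftchar_nontriv.
- apply: liftchar_pow => //; have := pchar_card k.
  by rewrite ck pnatX expn_eq0 /= orbF.
split; first by rewrite fmorph_eq0.
rewrite (hasse_davenport i2 cL chk ntk b0).
set K := kloosterman psik b in hk *; set Q := #|k| in hk cL *.
set e := 4 ^+ j * delta in hk.
have e0 : 0 <= e by rewrite mulr_ge0 // exprn_ge0 // ler0n.
have low : (2 + e) * Q%:R <= `|2 * Q%:R - K ^+ 2|.
  rewrite distrC; apply: le_trans (lerB_dist _ _).
  rewrite normrX normrM !normr_nat lerBrDr; apply: le_trans hk.
  by rewrite le_eqVlt; apply/orP; left; apply/eqP; ring.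
apply: le_trans (_ : ((2 + e) * Q%:R) ^+ 2 <= _); last first.
  by rewrite lerXn2r ?nnegrE // mulr_ge0 ?addr_ge0 // ler0n.
rewrite cL natrX exprMn ler_wpM2r ?exprn_ge0 ?ler0n // exprS -mulrA -/e -subr_ge0.
have -> : (2 + e) ^+ 2 - (4 + 4 * e) = e ^+ 2 by ring.
exact: exprn_ge0.
Qed.

(** Otherwise |K|^2 / |k| tends to infinity in the tower, while
    [kloosterman_stepanov] bounds it by 9 q^2 for all the fields with q^(2^j)
    elements, j > 2. *)
Theorem kloosterman_bound : `|kloosterman psi a| ^+ 2 <= 4 * q%:R.
Proof.
have q1 : (1 < q)%N by exact: finNzRing_gt1.
rewrite real_leNgt ?realX ?normr_real ?realM ?realn //; apply/negP => hlt.
have qp : (0 : algC) < q%:R by rewrite ltr0n ltnW.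
pose delta : algC := `|kloosterman psi a| ^+ 2 / q%:R - 4.
have d_gt0 : 0 < delta by rewrite subr_gt0 ltr_pdivlMr.
have hd : (4 + delta) * q%:R <= `|kloosterman psi a| ^+ 2.
  by rewrite /delta addrC subrK divfK ?gt_eqF.
have bnd j : (2 < j)%N -> 4 ^+ j * delta <= 9 * q%:R ^+ 2.
  move=> j2; have [k [iota [psik [b [ck chk ntk frk [b0 hk]]]]]] := kloosterman_amplification (ltW d_gt0)
    hd j.
  (* The field at level j has (q^(r+1))^2 elements. *)
  pose r := (2 ^ j.-1 - 1)%N.
  have r1 : r.+1 = (2 ^ j.-1)%N by rewrite /r -subSn ?subn1 // expn_gt0.
  have r3 : (3 <= r)%N by rewrite -ltnS r1 (@leq_exp2l 2 2) //; lia.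
  have w_big : (q + 3 < q ^ r)%N.
    apply: leq_trans (leq_pexp2l (ltnW q1) r3); rewrite !expnS expn0; nia.
  have cs : #|k| = ((q * q ^ r) ^ 2)%N.
    by rewrite ck -expnS r1 -expnM mulnC -expnS prednK //; lia.
  have qpch : [pchar k].-nat q.
    by have := pchar_card k; rewrite ck pnatX expn_eq0 /= orbF.
  have fixq : (q <= #|[set c : k | c ^+ q == c]|)%N.
    have <- : #|[set iota x | x in [set: F]]| = q.
      by rewrite card_imset ?cardsT //; exact: fmorph_inj.
    apply/subset_leq_card/subsetP => _ /imsetP [x _ ->].
    by rewrite inE card_imset ?cardsT -?rmorphXn ?expf_card //; exact: fmorph_inj.
  have := kloosterman_stepanov b q1 qpch w_big cs fixq chk ntk frk.
  set s := (q * q ^ r)%N in cs *; move=> hs.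
  have hs3 : `|kloosterman psik b| <= (3 * q * s)%:R.
    apply: le_trans hs _; rewrite ler_nat.
    have : (0 < q ^ r)%N by rewrite expn_gt0 ltnW.
    by rewrite /s; nia.
  have : (4 + 4 ^+ j * delta) * #|k|%:R <= 9 * q%:R ^+ 2 * #|k|%:R.
    apply: le_trans hk _.
    apply: le_trans (_ : (3 * q * s)%:R ^+ 2 <= _); first by rewrite lerXn2r ?nnegrE
      ?ler0n.
    by rewrite cs !natrM natrX le_eqVlt; apply/orP; left; apply/eqP; ring.
  rewrite ler_pM2r; last by rewrite ltr0n; apply/card_gt0P; exists 0.
  by apply: le_trans; rewrite lerDr ler0n.
pose B := (9 * q%:R ^+ 2 / delta : algC).
have B0 : 0 <= B by rewrite divr_ge0 ?mulr_ge0 ?exprn_ge0 ?ler0n // ltW.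
have [n hn] : exists n : nat, B < n%:R by exists (Num.bound B); apply: archi_boundP.
have := bnd (n + 3)%N; rewrite addn3 => /(_ isT).
rewrite -ler_pdivlMr // -/B => /le_lt_trans /(_ hn).
rewrite -natrX ltr_nat ltnNge => /negP; apply.
by apply: ltnW; apply: leq_trans (ltn_expl n.+3 (isT : (1 < 4)%N)); lia.
Qed.
End Weil.

(** * Fourier analysis on F^d and the kernel of a sphere *)

(** The irreducible characters of the additive group separate its elements, and
    they are linear since the group is abelian. *)
Lemma exists_nontrivial_char (F : finFieldType) :
  exists psi : F -> algC, additive_char psi /\ exists x, psi x != 1.
Proof.
pose G := [set: F]%G.
have abG : abelian G by exact: FinRing.Theory.zmod_abelian.
have [i hi] : exists i, (1 : F) \notin cfker 'chi[G]_i.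
  apply/existsP; rewrite -negb_forall; apply/negP => /forallP h.
  have : (1 : F) \in \bigcap_i cfker 'chi[G]_i by apply/bigcapP => i _; exact: h.
  by rewrite TI_cfker_irr => /set1P /eqP; rewrite oner_eq0.
have lin : 'chi[G]_i \is a linear_char by have /char_abelianP := abG; apply.
exists 'chi_i; split; last first.
  exists 1; apply: contra hi => /eqP hi.
  by rewrite cfkerEirr inE /= hi -(lin_char1 lin).
split; first exact: (lin_char1 lin).
by move=> x y; exact: (lin_charM lin (in_setT x) (in_setT y)).
Qed.

Section Fourier.
Variables (F : finFieldType) (psi : F -> algC).
Hypothesis psiP : additive_char psi.
Hypothesis psi_nontriv : exists x, psi x != 1.
Let q := #|F|.
Variable d : nat.

Lemma sum_rV_prod (h : 'I_d -> F -> algC) :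
  \sum_(x : 'rV[F]_d) \prod_i h i (x 0 i) = \prod_i \sum_t h i t.
Proof.
rewrite bigA_distr_bigA /= (reindex (fun f : {ffun 'I_d -> F} => \row_i f i)) /=.
  by apply: eq_bigr => f _; apply: eq_bigr => i _; rewrite mxE.
exists (fun x : 'rV_d => [ffun i => x 0 i]) => [f _|x _].
  by apply/ffunP => i; rewrite ffunE mxE.
by apply/rowP => i; rewrite mxE ffunE.
Qed.

Definition dot (x m : 'rV[F]_d) : F := \sum_i x 0 i * m 0 i.

Lemma dotDl x y m : dot (x + y) m = dot x m + dot y m.
Proof. by rewrite -big_split; apply: eq_bigr => i _; rewrite mxE mulrDl. Qed.

Lemma dotNl x m : dot (- x) m = - dot x m.
Proof. by rewrite -sumrN; apply: eq_bigr => i _; rewrite mxE mulNr. Qed.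

Lemma psi_sum (I : Type) (r : seq I) (P : pred I) (f : I -> F) :
  psi (\sum_(i <- r | P i) f i) = \prod_(i <- r | P i) psi (f i).
Proof. by apply: (big_morph psi (psiD psiP) (psi0 psiP)). Qed.

Lemma sum_psi_dot z : \sum_m psi (dot z m) = if z == 0 then (q ^ d)%:R else 0.
Proof.
under eq_bigr do rewrite psi_sum.
rewrite (sum_rV_prod (fun i t => psi (z 0 i * t))).
under eq_bigr do rewrite (sum_psi_mul psiP psi_nontriv).
case: eqP => [->|/eqP/rV0Pn [i zi]].
  under eq_bigr do rewrite mxE eqxx.
  by rewrite prodr_const card_ord natrX.
by rewrite (bigD1 i) //= (negPf zi) mul0r.
Qed.

Definition FT (f : 'rV[F]_d -> algC) (m : 'rV[F]_d) : algC :=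
  \sum_x f x * psi (dot x m).

Lemma plancherel f : \sum_m `|FT f m| ^+ 2 = (q ^ d)%:R * \sum_x `|f x| ^+ 2.
Proof.
have conjFT m : (FT f m)^* = \sum_y (f y)^* * psi (- dot y m).
  by rewrite rmorph_sum; apply: eq_bigr => y _; rewrite rmorphM /= -(psi_conj psiP).
transitivity (\sum_m \sum_x \sum_y f x * (f y)^* * psi (dot (x - y) m)).
  apply: eq_bigr => m _; rewrite normCK conjFT /FT big_distrlr /=.
  apply: eq_bigr => x _; apply: eq_bigr => y _.
  by rewrite dotDl dotNl (psiD psiP); ring.
rewrite exchange_big /= mulr_sumr; apply: eq_bigr => x _.
rewrite exchange_big /=; under eq_bigr => y _ do rewrite -mulr_sumr sum_psi_dot
  subr_eq0.
rewrite (bigD1 x) //= eqxx big1 => [|y /negPf yx]; last by rewrite eq_sym yx mulr0.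
by rewrite addr0 normCK mulrC.
Qed.

Lemma FT_conv f g m : FT (fun x => \sum_y f y * g (x - y)) m = FT f m * FT g m.
Proof.
rewrite /FT mulr_suml; under eq_bigr => x _ do rewrite mulr_suml.
rewrite exchange_big /=; apply: eq_bigr => y _.
rewrite mulr_sumr (reindex_inj (addIr y)) /=; apply: eq_bigr => x _.
by rewrite addrK dotDl (psiD psiP); ring.
Qed.
End Fourier.

Section Gauss.
Variables (F : finFieldType) (psi : F -> algC).
Hypothesis oddF : odd #|F|.
Hypothesis psiP : additive_char psi.
Hypothesis psi_nontriv : exists x, psi x != 1.
Let q := #|F|.
Let n2 : (2 : F) != 0. Proof. exact: two_neq0. Qed.

Definition gauss (s : F) : algC := \sum_z psi (s * z ^+ 2).

Lemma four_neq0 : (4 : F) != 0.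
Proof. by rewrite -[4]/(2 * 2)%:R natrM mulf_neq0. Qed.

(** Completing the square. *)
Lemma gauss_linear s b : s != 0 ->
  \sum_z psi (s * z ^+ 2 + b * z) = gauss s * psi (- (b ^+ 2 / (4 * s))).
Proof.
move=> s0; rewrite /gauss mulr_suml (reindex_inj (addIr (- (b / (2 * s))))) /=.
apply: eq_bigr => z _; rewrite -(psiD psiP); congr psi.
by field; rewrite ?s0 ?n2 ?four_neq0.
Qed.

Lemma gauss_norm s : s != 0 -> `|gauss s| ^+ 2 = q%:R.
Proof.
move=> s0; rewrite normCK /gauss rmorph_sum big_distrlr /=.
transitivity (\sum_w \sum_h psi (s * h ^+ 2) * psi ((2 * s * h) * w)).
  rewrite exchange_big /=; apply: eq_bigr => w _.
  rewrite (reindex_inj (addIr w)) /=; apply: eq_bigr => h _.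
  by rewrite (psi_conj psiP) -!(psiD psiP); congr psi; ring.
rewrite exchange_big /=.
under eq_bigr => h _ do rewrite -mulr_sumr (sum_psi_mul psiP psi_nontriv).
rewrite (bigD1 0) //= mulr0 eqxx big1 => [|h /negPf h0].
  by rewrite expr0n mulr0 (psi0 psiP) mul1r addr0.
by rewrite !mulf_eq0 (negPf n2) (negPf s0) h0 mulr0.
Qed.

Lemma gauss_square s r : r != 0 -> gauss (s * r ^+ 2) = gauss s.
Proof.
move=> r0; rewrite /gauss [RHS](reindex_inj (mulfI r0)) /=.
by apply: eq_bigr => z _; congr psi; ring.
Qed.

Lemma card_sqrt_le (v : F) : (#|[pred z : F | (z ^+ 2 == v)%R]| <= 2)%N.
Proof.
case: (pickP [pred z : F | z ^+ 2 == v]) => [z0 /= /eqP h|h]; last by rewrite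
  (eq_card0 h).
apply: leq_trans (_ : #|pred2 z0 (- z0)| <= 2)%N; last by rewrite card2; case: (_ != _).
apply/subset_leq_card/subsetP => z; rewrite !inE -h => /eqP hz.
by rewrite -subr_eq0 -[X in _ || X]subr_eq0 -mulf_eq0 opprK -subr_sqr hz subrr.
Qed.

(** Together, the z^2 and the mu z^2 take each value exactly twice: at most twice
    because mu is not a square, and 2 q times in total. So the two Gauss sums add
    up to twice the sum of the psi(s v) over all v, which is 0. *)
Lemma gauss_nonsquare s mu : s != 0 -> (forall x, x ^+ 2 != mu) -> gauss (mu * s) = -
  gauss s.
Proof.
move=> s0 hmu; have mu0 : mu != 0 by rewrite eq_sym; have := hmu 0; rewrite expr0n.
pose n1 v := #|[pred z : F | z ^+ 2 == v]|.
pose nmu v := #|[pred z : F | mu * z ^+ 2 == v]|.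
have nmuE v : nmu v = n1 (v / mu).
  apply: eq_card => z; rewrite !inE; apply/eqP/eqP => [<-|->]; first by field.
  by field.
have le2 v : (n1 v + nmu v <= 2)%N.
  have [->|v0] := eqVneq v 0.
    rewrite nmuE mul0r; have -> : n1 0 = 1%N; last by [].
    by rewrite /n1 (@eq_card1 _ 0) // => z; rewrite !inE sqrf_eq0.
  case: (pickP [pred z : F | z ^+ 2 == v]) => [z /= /eqP hz|h]; last first.
    by rewrite /n1 (eq_card0 h) add0n nmuE card_sqrt_le.
  case: (pickP [pred z : F | mu * z ^+ 2 == v]) => [z' /= /eqP hz'|h]; last first.
    by rewrite /nmu (eq_card0 h) addn0 card_sqrt_le.
  have z'0 : z' != 0 by apply: contraNneq v0 => e; rewrite -hz' e expr0n mulr0.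
  have /eqP [] := hmu (z / z'); rewrite expr_div_n hz -hz'; field.
  exact: z'0.
have sum1 : (\sum_v n1 v = q)%N.
  by rewrite /q -[RHS]sum1_card [RHS](partition_big (fun z => z ^+ 2) predT) //=;
     apply: eq_bigr => v _; rewrite /n1 -sum1_card.
have summu : (\sum_v nmu v = q)%N.
  by rewrite /q -[RHS]sum1_card [RHS](partition_big (fun z => mu * z ^+ 2) predT) //=;
     apply: eq_bigr => v _; rewrite /nmu -sum1_card.
have eq2 v : (n1 v + nmu v = 2)%N.
  have : (\sum_v (2 - (n1 v + nmu v)) = 0)%N.
    by rewrite sumnB // big_split /= sum1 summu sum_nat_const mulnC mul2n addnn subnn.
  by move/eqP; rewrite sum_nat_eq0 => /forallP /(_ v) /= /eqP; have := le2 v; lia.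
apply/eqP; rewrite -addr_eq0; apply/eqP.
have g1 : gauss s = \sum_v psi (s * v) *+ n1 v.
  rewrite /gauss (partition_big (fun z => z ^+ 2) predT) //=; apply: eq_bigr => v _.
  by rewrite (eq_bigr (fun=> psi (s * v))) ?sumr_const // => z /eqP <-.
have g2 : gauss (mu * s) = \sum_v psi (s * v) *+ nmu v.
  rewrite /gauss (partition_big (fun z => mu * z ^+ 2) predT) //=; apply: eq_bigr =>
    v _.
  rewrite (eq_bigr (fun=> psi (s * v))) ?sumr_const // => z /eqP <-.
  by congr psi; ring.
rewrite g1 g2 addrC -big_split /=.
under eq_bigr => v _ do rewrite -mulrnDr eq2.
by rewrite sumrMnl (sum_psi_mul psiP psi_nontriv) (negPf s0) mul0rn.
Qed.

Lemma gauss_sqr s : s != 0 -> gauss s ^+ 2 = gauss 1 ^+ 2.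
Proof.
move=> s0; case: (pickP [pred x : F | x ^+ 2 == s]) => [r /= /eqP rs|h].
  have r0 : r != 0 by apply: contraNneq s0 => e; rewrite -rs e expr0n.
  by rewrite -rs -[r ^+ 2]mul1r gauss_square.
by rewrite -[s]mulr1 gauss_nonsquare ?oner_eq0 ?sqrrN // => x; have /negbT := h x.
Qed.

(** Since gauss s is gauss 1 times the quadratic character of s, this is a Salie
    sum multiplied by gauss 1. *)
Definition salie (t mu : F) : algC :=
  \sum_(s | s != 0) psi (- (s * t)) * gauss s * psi (- (mu / (4 * s))).

Lemma sum_psi_units b : \sum_(s | s != 0) psi (b * s) = (if b == 0 then q%:R else 0)
  - 1.
Proof.
rewrite -(sum_psi_mul psiP psi_nontriv) [in RHS](bigD1 0) //= mulr0 (psi0 psiP).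
by rewrite addrAC subrr add0r.
Qed.

(** Undoing [gauss_linear] turns the sum over s into the orthogonality relation
    that selects the z with z^2 = t, of which there are at most two. *)
Lemma salie_square t c : t != 0 -> `|salie t (c ^+ 2)| <= 2 * q%:R.
Proof.
move=> t0; pose S := \sum_(z | z ^+ 2 == t) psi (c * z).
have -> : salie t (c ^+ 2) = q%:R * S - \sum_z psi (c * z).
  transitivity (\sum_(s | s != 0) \sum_z psi ((z ^+ 2 - t) * s) * psi (c * z)).
    apply: eq_bigr => s s0; rewrite -mulrA -gauss_linear // mulr_sumr.
    by apply: eq_bigr => z _; rewrite -!(psiD psiP); congr psi; ring.
  rewrite exchange_big /= /S mulr_sumr [in X in X - _]big_mkcond -sumrB.
  apply: eq_bigr => z _; rewrite -mulr_suml sum_psi_units subr_eq0.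
  by case: eqP => _; ring.
rewrite (sum_psi_mul psiP psi_nontriv); have := card_sqrt_le t.
set n := #|_| => n_le2; have [c0|c0] := eqVneq c 0.
  have -> : S = n%:R.
    by rewrite /S (eq_bigr (fun=> 1)) ?sumr_const // => z _; rewrite c0 mul0r (psi0
      psiP).
  rewrite -[X in _ - X]mulr1 -mulrBr normrM normr_nat mulrC ler_wpM2r ?ler0n //.
  case: n n_le2 => [|[|[|//]]] _.
  - by rewrite sub0r normrN1 ler1n.
  - by rewrite subrr normr0 ler0n.
  - by rewrite (_ : 2 - 1 = 1 :> algC) ?normr1 ?ler1n //; ring.
rewrite subr0 normrM normr_nat mulrC ler_wpM2r ?ler0n //.
apply: le_trans (ler_norm_sum _ _ _) _.
under eq_bigr => z _ do rewrite (psi_norm psiP).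
by rewrite sumr_const ler_nat.
Qed.

(** If mu is not a square, the substitution s -> mu s reduces to the case
    mu = 1. *)
Lemma salie_bound t mu : t != 0 -> `|salie t mu| <= 2 * q%:R.
Proof.
move=> t0; case: (pickP [pred x : F | x ^+ 2 == mu]) => [r /= /eqP <-|h]; first
  exact: salie_square.
have hmu x : x ^+ 2 != mu by have /negbT := h x.
have mu0 : mu != 0 by rewrite eq_sym; have := hmu 0; rewrite expr0n.
have -> : salie t mu = - salie (mu * t) (1 ^+ 2).
  rewrite /salie (reindex_inj (mulfI mu0)) /= -sumrN.
  apply: eq_big => [s|s]; first by rewrite mulf_eq0 negb_or mu0.
  rewrite mulf_eq0 negb_or => /andP [_ s0].
  rewrite gauss_nonsquare // mulrN mulNr; congr (- (psi _ * _ * psi _)); first by ring.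
  by field; rewrite ?s0 ?mu0 ?four_neq0.
by rewrite normrN salie_square // mulf_neq0.
Qed.

(** The substitution s -> - s / t. *)
Lemma kloosterman_scaled t mu : t != 0 ->
  `|\sum_(s | s != 0) psi (- (s * t)) * psi (- (mu / (4 * s)))| ^+ 2 <= 4 * q%:R.
Proof.
move=> t0; have [->|mu0] := eqVneq mu 0.
  under eq_bigr => s _ do rewrite mul0r oppr0 (psi0 psiP) mulr1 -mulrN mulrC.
  rewrite sum_psi_units oppr_eq0 (negPf t0) sub0r normrN1 expr1n.
  have : (1 < q)%N by exact: finNzRing_gt1.
  by rewrite -natrM ler1n; lia.
have -> : \sum_(s | s != 0) psi (- (s * t)) * psi (- (mu / (4 * s))) = kloosterman
  psi (t * mu / 4).
  have nt0 : - t^-1 != 0 by rewrite oppr_eq0 invr_eq0.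
  rewrite /kloosterman (reindex_inj (mulfI nt0)) /=.
  apply: eq_big => [s|s]; first by rewrite mulf_eq0 negb_or nt0.
  rewrite mulf_eq0 negb_or => /andP [_ s0].
  by rewrite -(psiD psiP); congr psi; field; rewrite s0 t0 four_neq0 oppr_eq0 oner_eq0.
by apply: kloosterman_bound => //; rewrite !mulf_neq0 ?invr_eq0 ?four_neq0.
Qed.

Variable d : nat.

(** With the term s = 0 included, this would be q times the indicator function
    of the sphere of radius t; the omitted term is the constant 1. *)
Definition sphere_kernel (t : F) (z : 'rV[F]_d) : algC :=
  \sum_(s | s != 0) psi (s * (sqnorm z - t)).

(** The quadratic form is diagonal, so the transform of each psi(s ||z||) is a
    product of d sums in one variable. *)
Lemma FT_sphere_kernel t m : FT psi (sphere_kernel t) m =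
  \sum_(s | s != 0) psi (- (s * t)) * gauss s ^+ d * psi (- (sqnorm m / (4 * s))).
Proof.
rewrite /FT; under eq_bigr => z _ do rewrite mulr_suml.
rewrite exchange_big /=; apply: eq_bigr => s s0.
transitivity (psi (- (s * t)) * \sum_(z : 'rV[F]_d) \prod_i psi (s * z 0 i ^+ 2 + m 0
  i * z 0 i)).
  rewrite mulr_sumr; apply: eq_bigr => z _.
  rewrite -psi_sum // -!(psiD psiP); congr psi.
  have -> : \sum_i (s * z 0 i ^+ 2 + m 0 i * z 0 i) = s * sqnorm z + dot z m.
    rewrite big_split /= -mulr_sumr; congr (_ + _).
    by apply: eq_bigr => i _; rewrite mulrC.
  by ring.
rewrite (sum_rV_prod (fun i u => psi (s * u ^+ 2 + m 0 i * u))) -mulrA; congr (_ * _).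
under eq_bigr => i _ do rewrite gauss_linear //.
rewrite big_split /= prodr_const card_ord -psi_sum //; congr (_ * psi _).
by rewrite sumrN /sqnorm mulr_suml.
Qed.

(** As gauss s ^+ 2 does not depend on s, only the parity of d matters inside
    the sum over s. *)
Lemma FT_sphere_kernel_bound t m : t != 0 ->
  `|FT psi (sphere_kernel t) m| ^+ 2 <= 4 * (q ^ d.+1)%:R.
Proof.
move=> t0; rewrite FT_sphere_kernel; set mu := sqnorm m.
have g2n n : `|gauss 1 ^+ 2 ^+ n| = q%:R ^+ n.
  by rewrite !normrX gauss_norm ?oner_eq0.
have gd s : s != 0 -> gauss s ^+ d = (gauss 1 ^+ 2) ^+ d./2 * gauss s ^+ odd d.
  move=> s0; rewrite -{1}(odd_double_half d) addnC exprD -mul2n exprM.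
  by rewrite gauss_sqr.
have -> : \sum_(s | s != 0) psi (- (s * t)) * gauss s ^+ d * psi (- (mu / (4 * s))) =
   (gauss 1 ^+ 2) ^+ d./2 * \sum_(s | s != 0) psi (- (s * t)) * gauss s ^+ odd d *
     psi (- (mu / (4 * s))).
  by rewrite mulr_sumr; apply: eq_bigr => s s0; rewrite gd //; ring.
rewrite normrM g2n exprMn -exprM muln2 natrX.
case od : (odd d).
  have -> : 4 * q%:R ^+ d.+1 = q%:R ^+ d./2.*2 * (2 * q%:R) ^+ 2 :> algC.
    have -> : d.+1 = (d./2.*2).+2 by have := odd_double_half d; rewrite od; lia.
    by rewrite !exprS; ring.
  rewrite ler_wpM2l ?exprn_ge0 ?ler0n // lerXn2r ?nnegrE ?mulr_ge0 ?ler0n //.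
  exact: salie_bound.
have -> : 4 * q%:R ^+ d.+1 = q%:R ^+ d./2.*2 * (4 * q%:R) :> algC.
  have -> : d.+1 = (d./2.*2).+1 by have := odd_double_half d; rewrite od; lia.
  by rewrite !exprS; ring.
rewrite ler_wpM2l ?exprn_ge0 ?ler0n //.
under eq_bigr => s _ do rewrite expr0 mulr1.
exact: kloosterman_scaled.
Qed.

(** By [sum_psi_units], q deg(x) - |E| is the value at x of the convolution of
    the indicator function of E with the kernel. The Fourier transform turns this
    convolution into a product, one of whose factors is uniformly bounded. *)
Lemma degree_variance (E : {set 'rV[F]_d}) t : t != 0 ->
  \sum_x `|(q * #|[set y in E | sqnorm (x - y) == t]|)%:R - #|E|%:R| ^+ 2
    <= (4 * q ^ d.+1 * #|E|)%:R :> algC.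
Proof.
move=> t0; pose f x : algC := (x \in E)%:R.
pose g x := \sum_y f y * sphere_kernel t (x - y).
have gE x : (q * #|[set y in E | sqnorm (x - y) == t]|)%:R - #|E|%:R = g x.
  rewrite /g; under eq_bigr => y _.
    rewrite /f /sphere_kernel; under eq_bigr => s _ do rewrite mulrC.
    rewrite sum_psi_units subr_eq0 mulrBr mulr1; over.
  rewrite sumrB; congr (_ - _); last first.
    by rewrite -sumr_const [LHS]big_mkcond; apply: eq_bigr => y _; rewrite /f; case:
      (y \in E).
  rewrite natrM -[X in _ * X]sumr_const mulr_sumr [LHS]big_mkcond; apply: eq_bigr =>
    y _.
  rewrite inE /f; case: (y \in E); case: eqP => _ /=; ring.
have qd0 : (0 : algC) < (q ^ d)%:R.
  by rewrite ltr0n expn_gt0; apply/orP; left; apply/card_gt0P; exists 0.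
under eq_bigr => x _ do rewrite gE.
rewrite -(ler_pM2l qd0) -(plancherel psiP psi_nontriv).
under eq_bigr => m _ do rewrite FT_conv // normrM exprMn.
have sumf : \sum_m `|FT psi f m| ^+ 2 = (q ^ d)%:R * #|E|%:R.
  rewrite plancherel //; congr (_ * _); rewrite -sumr_const [RHS]big_mkcond.
  by apply: eq_bigr => x _; rewrite /f; case: (x \in E); rewrite ?normr1 ?normr0
    ?expr1n ?expr0n.
apply: le_trans (_ : \sum_m `|FT psi f m| ^+ 2 * (4 * (q ^ d.+1)%:R) <= _).
  by apply: ler_sum => m _; rewrite ler_wpM2l ?exprn_ge0 // FT_sphere_kernel_bound.
by rewrite -mulr_suml sumf !natrM le_eqVlt; apply/orP; left; apply/eqP; ring.
Qed.
End Gauss.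

(** * Stars *)

(** The value at the last index is chosen outside the image of the others. *)
Lemma greedy_injection (T : finType) n (A : 'I_n -> {set T}) :
  (forall i, (n <= #|A i|)%N) -> exists2 f : 'I_n -> T, injective f & forall i, f i
    \in A i.
Proof.
elim: n A => [|n IH] A hA; first by exists (ffun0 (card_ord 0)) => [[]|[]].
have [|f f_inj fA] := IH (fun i => A (lift ord_max i)).
  by move=> i; apply: ltnW; apply: hA.
have [y yA yf] : exists2 y, y \in A ord_max & y \notin codom f.
  have : (0 < #|A ord_max :\: [set y in codom f]|)%N.
    rewrite cardsD subn_gt0; apply: leq_trans (hA ord_max); rewrite ltnS.
    apply: leq_trans (subset_leq_card (subsetIr _ _)) _.
    by rewrite cardsE (leq_trans (card_size _)) // size_codom card_ord.
  by case/card_gt0P => y; rewrite !inE => /andP [yf yA]; exists y.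
pose f' i := if unlift ord_max i is Some j then f j else y.
exists f' => [i1 i2|i]; rewrite /f'.
  case: unliftP => [j1 ->|->]; case: unliftP => [j2 ->|->] //.
  - by move/f_inj => ->.
  - by move=> e; rewrite -e codom_f in yf.
  - by move=> e; rewrite e codom_f in yf.
by case: unliftP => [j ->|->].
Qed.

Section Stars.
Variables (F : finFieldType) (d : nat) (E : {set 'rV[F]_d}) (k : nat).
Hypothesis oddF : odd #|F|.
Let q := #|F|.

Definition sphere_nbhd (t : F) (x : 'rV[F]_d) := [set y in E | sqnorm (x - y) == t].

(** Chebyshev's inequality. At a bad center, q deg < q k <= |E| / 12, so that
    |q deg - |E|| >= (11/12) |E|; and 576 = 4 * 12^2. *)
Lemma few_bad_centers t : t != 0 -> (12 * q * k <= #|E|)%N ->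
  (121 * #|E| * #|[set x in E | #|sphere_nbhd t x| < k]%N| <= 576 * q ^ d.+1)%N.
Proof.
move=> t0 hk; set B := [set x in E | _].
have [psi [psiP psi_nontriv]] := exists_nontrivial_char F.
have var := degree_variance oddF psiP psi_nontriv E t0.
have [E0|E_gt0] := posnP #|E|; first by rewrite E0 muln0 mul0n.
rewrite -(leq_pmul2l E_gt0) -(ler_nat algC).
apply: le_trans (_ : (144 : algC) * (4 * q ^ d.+1 * #|E|)%:R <= _); last first.
  by rewrite -natrM ler_nat; nia.
have lowB : (#|B| * (11 * #|E|) ^ 2)%:R <= 144 * \sum_x `|(q * #|sphere_nbhd t x|)%:R
  - #|E|%:R| ^+ 2 :> algC.
  rewrite mulr_sumr (bigID (mem B)) /= -[X in X <= _]addr0; apply: lerD; last first.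
    by apply: sumr_ge0 => x _; rewrite mulr_ge0 ?exprn_ge0.
  rewrite natrM -sumr_const mulr_suml; apply: ler_sum => x.
  rewrite inE => /andP [_ degx]; rewrite mul1r.
  have qd : (12 * (q * #|sphere_nbhd t x|) <= #|E|)%N by apply: leq_trans hk; rewrite
    -mulnA !leq_mul2l (ltnW degx) !orbT.
  move: (q * _)%N qd => u qd; rewrite distrC -natrB; last by apply: leq_trans qd;
    exact: leq_pmull.
  by rewrite normr_nat -natrX -natrM ler_nat; move: #|E| qd => n qd; nia.
apply: le_trans (le_trans lowB _); first by rewrite ler_nat; nia.
by rewrite ler_wpM2l ?ler0n.
Qed.

(** Union bound over T, with 576 < 5 * 121. *)
Lemma exists_rich_center (T : {set F}) :
  (forall t, t \in T -> t != 0) -> (12 * q * k <= #|E|)%N ->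
  (#|T| * (5 * q ^ d.+1) < #|E| ^ 2)%N ->
  exists2 x, x \in E & forall t, t \in T -> (k <= #|sphere_nbhd t x|)%N.
Proof.
move=> T0 hk hT; pose B t := [set x in E | #|sphere_nbhd t x| < k]%N.
have E_gt0 : (0 < #|E|)%N by move: hT; case: #|E|.
have card_bad : (#|\bigcup_(t in T) B t| < #|E|)%N.
  apply: leq_ltn_trans (_ : \sum_(t in T) #|B t| < #|E|)%N.
    elim/big_rec2: _ => [|t m S _ h]; first by rewrite cards0.
    by apply: leq_trans (leq_card_setU _ _) _; rewrite leq_add2l.
  have : (121 * #|E| * \sum_(t in T) #|B t| <= #|T| * (576 * q ^ d.+1))%N.
    rewrite big_distrr -sum_nat_const; apply: leq_sum => t tT.
    by apply: few_bad_centers => //; exact: T0.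
  by move: hT E_gt0; move: (\sum_(t in T) _)%N (q ^ _)%N #|E| #|T| => S Q e n; nia.
have : (0 < #|E :\: \bigcup_(t in T) B t|)%N.
  rewrite cardsD subn_gt0; apply: leq_ltn_trans card_bad.
  by apply/subset_leq_card/subsetIr.
case/card_gt0P => x; rewrite inE => /andP [xB xE]; exists x => // t tT.
rewrite leqNgt; apply: contra xB => degx; apply/bigcupP; exists t => //.
by rewrite inE xE.
Qed.

Lemma stars_exist (t : 'I_k -> F) : (forall i, t i != 0) ->
  (12 * q * k <= #|E|)%N -> (#|[set t i | i : 'I_k]| * (5 * q ^ d.+1) < #|E| ^ 2)%N ->
  (0 < nu E t)%N.
Proof.
move=> t0 hk hT.
have [|x xE hx] := exists_rich_center _ hk hT; first by move=> _ /imsetP [i _ ->].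
have [i|f f_inj fA] := @greedy_injection _ _ (fun i => sphere_nbhd (t i) x).
  by apply: hx; apply: imset_f.
apply/card_gt0P; exists (x, finfun f); rewrite inE /= xE /=.
apply/and3P; split; apply/forallP => i; rewrite ?ffunE.
- by have := fA i; rewrite inE => /andP [].
- by have := fA i; rewrite inE => /andP [].
- by apply/forallP => j; rewrite !ffunE (inj_eq f_inj).
Qed.
End Stars.

Lemma powR_half_sqr (R : realType) (q n : nat) : (0 < q)%N ->
  ((q%:R : R) `^ (n%:R / 2)) ^+ 2 = q%:R ^+ n.
Proof.
move=> q0; rewrite -powR_mulrn ?powR_ge0 // -powRrM divfK ?pnatr_eq0 //.
by rewrite powR_mulrn ?ler0n.
Qed.

Theorem theorem1p5 (R : realType) (F : finFieldType) (q d : nat)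
    (hq : #|F| = q) (q_odd : odd q)
    (E : {set 'rV[F]_d}) (k : nat) (hk : (1 <= k)%N)
    (t : 'I_k -> F) (ht : forall i : 'I_k, t i != 0) :
  ((#|E|%:R : R) > 12 * q%:R `^ ((d%:R + 1) / 2) ->
   (k%:R : R) < #|E|%:R / (12 * q%:R `^ ((d%:R + 1) / 2)) ->
   (0 < nu E t)%N)
  /\
  ((#|E|%:R : R) > 12 * q%:R `^ ((d%:R + 3) / 2) ->
   (k%:R : R) < #|E|%:R / (12 * q%:R) ->
   (0 < nu E t)%N).
Proof.
have q1 : (1 < q)%N by rewrite -hq finNzRing_gt1.
have oddF : odd #|F| by rewrite hq.
have qR : (1 : R) <= q%:R by rewrite ler1n ltnW.
have -> : (d%:R + 1 : R) = d.+1%:R by rewrite natr1.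
have -> : (d%:R + 3 : R) = d.+3%:R by rewrite -[d.+3]addn3 natrD.
have img_k : (#|[set t i | i : 'I_k]| <= k)%N by rewrite (leq_trans (leq_imset_card _
  _)) // card_ord.
have img_q : (#|[set t i | i : 'I_k]| <= q)%N by rewrite -hq max_card.
split.
  set Z := q%:R `^ _; have Z2 : Z ^+ 2 = (q ^ d.+1)%:R :> R by rewrite powR_half_sqr
    ?natrX // ltnW.
  have Z1 : 1 <= Z by rewrite -[1](powRr0 (q%:R : R)) ler_powR // divr_ge0 // ler0n.
  have Z0 : 0 < Z by apply: lt_le_trans Z1.
  move=> hE; rewrite ltr_pdivlMr ?mulr_gt0 // => hkE.
  (* For d = 0 there is only one point, while |E| > 12. *)
  have d0 : (0 < d)%N.
    rewrite lt0n; apply/negP => /eqP d0.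
    have : (#|E| <= 1)%N by rewrite (leq_trans (max_card _)) // card_mx d0 muln0 expn0.
    by rewrite -(ler_nat R); lra.
  (* This makes the bound on k at least as strong as k < |E| / (12 q). *)
  have qZ : q%:R <= Z.
    rewrite -[X in X <= _](powRr1 (ler0n R q)) ler_powR // ler_pdivlMr // mul1r ler_nat.
    by rewrite ltnS.
  apply: stars_exist => //; rewrite hq.
    rewrite -(ler_nat R) !natrM; apply: ltW; apply: le_lt_trans hkE.
    by rewrite [X in _ <= X]mulrC ler_wpM2r ?ler0n // ler_wpM2l.
  apply: leq_ltn_trans (_ : k * (5 * q ^ d.+1) < _)%N; first by rewrite leq_mul2r
    img_k orbT.
  rewrite -(ltr_nat R) natrX !natrM -Z2.
  have kR : (1 : R) <= k%:R by rewrite ler1n.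
  by move: hE hkE; move: (k%:R : R) kR Z1 => kk kR Z1; nra.
set Z := q%:R `^ _; have Z2 : Z ^+ 2 = (q ^ d.+3)%:R :> R by rewrite powR_half_sqr
  ?natrX // ltnW.
have Z0 : 0 <= Z by exact: powR_ge0.
have q0 : (0 : R) < q%:R by apply: lt_le_trans qR.
move=> hE; rewrite ltr_pdivlMr ?mulr_gt0 // => hkE.
apply: stars_exist => //; rewrite hq.
  by rewrite -(ler_nat R) !natrM mulrC ltW.
apply: leq_ltn_trans (_ : q * (5 * q ^ d.+1) < _)%N; first by rewrite leq_mul2r img_q
  orbT.
rewrite -(ltr_nat R); apply: le_lt_trans (_ : 144 * Z ^+ 2 < _); last first.
  by rewrite natrX; nra.
rewrite Z2 -natrM ler_nat !expnS; nia.
Qed.
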